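(* Let $n\geq 1$, let $\mathcal{X}^1,\dots,\mathcal{X}^n,\mathcal{Y}$ be $\mathcal{C}^\infty$-smooth functions of $(x^1,\dots,x^n,y)\in\mathbb{K}^{n+1}$, and let $\mathbf{Y}_{i_1,\dots,i_\kappa}$ be the coefficients of the prolongations of the vector field $\sum_{i=1}^n\mathcal{X}^i\frac{\partial}{\partial x^i}+\mathcal{Y}\frac{\partial}{\partial y}$, as defined in the context. For every $\kappa\geq 1$ and every choice of indices $i_1,\dots,i_\kappa\in\{1,\dots,n\}$, $$ \begin{aligned} \mathbf{Y}_{i_1,\dots,i_\kappa} &=\frac{\partial^\kappa\mathcal{Y}}{\partial x^{i_1}\cdots\partial x^{i_\kappa}} +\sum_{d=1}^{\kappa+1}\ \sum_{1\leq\lambda_1<\cdots<\lambda_d\leq\kappa}\ \sum_{\substack{\mu_1\geq1,\dots,\mu_d\geq1\\ \mu_1\lambda_1+\cdots+\mu_d\lambda_d\leq\kappa+1}}\ \sum_{k_1,\dots,k_M=1}^n\\ &\Bigg[\sum_{\sigma\in\mathfrak{F}_M^{(\mu_1,\lambda_1),\dots,(\mu_d,\lambda_d)}}\ \sum_{\tau\in\mathfrak{S}_\kappa^{M}} \delta_{i_{\tau(1)},\dots,i_{\tau(M)}}^{k_{\sigma(1)},\dots,k_{\sigma(M)}}\, \frac{\partial^{\kappa-M+p}\,\mathcal{Y}}{\partial x^{i_{\tau(M+1)}}\cdots\partial x^{i_{\tau(\kappa)}}(\partial y)^{p}}\\ &\ -\sum_{\sigma\in\mathfrak{F}_M^{(\mu_1,\lambda_1),\dots,(\mu_d,\lambda_d)}}\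 \sum_{\tau\in\mathfrak{S}_\kappa^{M-1}} \delta_{i_{\tau(1)},\dots,i_{\tau(M-1)}}^{k_{\sigma(1)},\dots,k_{\sigma(M-1)}}\, \frac{\partial^{\kappa-M+p}\,\mathcal{X}^{k_{\sigma(M)}}}{\partial x^{i_{\tau(M)}}\cdots\partial x^{i_{\tau(\kappa)}}(\partial y)^{p-1}}\Bigg]\\ &\cdot\prod_{1\leq\nu_1\leq\mu_1}y_{k_{1:\nu_1:1},\dots,k_{1:\nu_1:\lambda_1}}\ \cdots\prod_{1\leq\nu_d\leq\mu_d}y_{k_{d:\nu_d:1},\dots,k_{d:\nu_d:\lambda_d}}, \end{aligned} $$ where, in each term, $M:=\mu_1\lambda_1+\cdots+\mu_d\lambda_d$, $p:=\mu_1+\cdots+\mu_d$, and the indices $k_1,\dots,k_M$ are also written $k_{e:\nu:\gamma}$ as explained in the context.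
   Context: $\mathbb{K}=\mathbb{R}$ or $\mathbb{C}$. Independent variables $x^1,\dots,x^n$, one dependent variable $y$. Jet variables and prolongation. The jet coordinates are $x^i,\ y,\ y_{i_1},\ y_{i_1,i_2},\dots$, where $y_{i_1,\dots,i_\lambda}$ (with $1\le i_1,\dots,i_\lambda\le n$) is symmetric in its indices and otherwise all coordinates are independent. $D_i^\lambda$ is the total differentiation operator $$D_i^\lambda=\frac{\partial}{\partial x^i}+y_i\frac{\partial}{\partial y}+\sum_{k_1}y_{i,k_1}\frac{\partial}{\partial y_{k_1}}+\cdots+\sum_{k_1,\dots,k_{\lambda-1}}y_{i,k_1,\dots,k_{\lambda-1}}\frac{\partial}{\partial y_{k_1,\dots,k_{\lambda-1}}},$$ where each distinct jet coordinate is counted once in the sums; i.e. $D_i^\lambda$ is the derivation with $D_i^\lambda x^j=\delta_i^j$, $D_i^\lambda y=y_i$, $D_i^\lambda y_{k_1,\dots,k_q}=y_{i,k_1,\dots,k_q}$ for $q\leq\lambda-1$. The coefficients of the $\kappa$-th prolongation are defined inductively by $$\mathbf{Y}_{i_1}:=D_{i_1}^1(\mathcal{Y})-\sum_{k=1}^nD_{i_1}^1(\mathcal{X}^k)\,y_k,\qquad \mathbf{Y}_{i_1,\dots,i_\lambda}:=D_{i_\lambda}^\lambda(\mathbf{Y}_{i_1,\dots,i_{\lambda-1}})-\sum_{k=1}^nD_{i_\lambda}^1(\mathcal{X}^k)\,y_{i_1,\dots,i_{\lambda-1},k}.$$ Index identification. Given integers $1\le\lambda_1<\cdots<\lambda_d$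 and $\mu_1,\dots,\mu_d\geq1$, with $M=\sum_e\mu_e\lambda_e$, identify $\{1,\dots,M\}$ with the set of triples $e\!:\!\nu\!:\!\gamma$ ($1\leq e\leq d$, $1\leq\nu\leq\mu_e$, $1\leq\gamma\leq\lambda_e$) by listing the triples in lexicographic order $1\!:\!1\!:\!1,\dots,1\!:\!1\!:\!\lambda_1,\dots,1\!:\!\mu_1\!:\!\lambda_1,\dots,d\!:\!\mu_d\!:\!\lambda_d$. So $k_{e:\nu:\gamma}$ is one of $k_1,\dots,k_M$. Kronecker symbols. $\delta_{i_1,\dots,i_q}^{k_1,\dots,k_q}:=\delta_{i_1}^{k_1}\cdots\delta_{i_q}^{k_q}$ (product of ordinary Kronecker symbols; equal to $1$ if $q=0$). Permutations. $\mathfrak{S}_p$ is the full permutation group of $\{1,\dots,p\}$. For $1\leq q\leq p-1$, $\mathfrak{S}_p^q$ is the set of $\tau\in\mathfrak{S}_p$ with $\tau(1)<\cdots<\tau(q)$ and $\tau(q+1)<\cdots<\tau(p)$; moreover $\mathfrak{S}_p^0=\mathfrak{S}_p^p=\{\mathrm{id}\}$ and $\mathfrak{S}_p^{p+1}=\emptyset$ (sums over it are $0$). $\mathfrak{H}_M^{(\mu_1,\lambda_1),\dots,(\mu_d,\lambda_d)}$ is the subgroup of those $h\in\mathfrak{S}_M$ which leave the monomial $\prod_{e=1}^d\prod_{\nu=1}^{\mu_e}y_{k_{e:\nu:1},\dots,k_{e:\nu:\lambda_e}}$ formally unchanged when every $k_\alpha$ is replaced by $k_{h(\alpha)}$; equivalently,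 for each $e$, $h$ permutes among themselves the $\mu_e$ blocks $\{e\!:\!\nu\!:\!1,\dots,e\!:\!\nu\!:\!\lambda_e\}$, $1\leq\nu\leq\mu_e$. It has cardinality $\mu_1!(\lambda_1!)^{\mu_1}\cdots\mu_d!(\lambda_d!)^{\mu_d}$. $\mathfrak{F}_M^{(\mu_1,\lambda_1),\dots,(\mu_d,\lambda_d)}$ is the quotient of $\mathfrak{S}_M$ by this subgroup; a sum over $\sigma\in\mathfrak{F}_M^{\dots}$ means a sum over an arbitrary fixed complete set of representatives $\sigma$ of the cosets $\mathfrak{H}\sigma=\{h\circ\sigma:h\in\mathfrak{H}\}$. *)

(* Defs.v *)
From HB Require Import structures.
From mathcomp Require Import all_boot all_order all_algebra all_fingroup.
From mathcomp Require Import all_classical all_reals all_analysis.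
From mathcomp Require Import complex.

Set Implicit Arguments.
Unset Strict Implicit.
Unset Printing Implicit Defensive.

Import Order.TTheory GRing.Theory Num.Theory numFieldNormedType.Exports.

Local Open Scope ring_scope.

Variant scalar_kind := RealScalars | ComplexScalars.

Definition scalars (R : realType) (c : scalar_kind) : numFieldType :=
  match c with RealScalars => R | ComplexScalars => R[i] end.

Section Base.
Variables (K : numFieldType) (n : nat).

(* The space K^{n+1} of the variables (x^1, ..., x^n, y). *)
Definition base : normedModType K := ('rV[K]_n * K)%type.

(* Differentiation directions: [Some i] is x^i and [None] is y.  Over R[i] the
   derivatives are complex derivatives. *)
Definition base_dir (c : option 'I_n) : base :=
  if c is Some i then (delta_mx 0 i, 0) else (0, 1).

Definition pd (c : option 'I_n) (f : base -> K) : base -> K :=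
  fun a => 'D_(base_dir c) f a.

(* pds [:: c_1; ...; c_r] f is d^r f / d c_1 ... d c_r. *)
Definition pds (s : seq (option 'I_n)) (f : base -> K) : base -> K :=
  foldr pd f s.

Definition smooth (f : base -> K) : Prop :=
  forall s : seq (option 'I_n), continuous (pds s f) /\
    forall (c : option 'I_n) (a : base), derivable (pds s f) a (base_dir c).

(* d^{|s| + q} f / d x^{s_1} ... d x^{s_r} (d y)^q *)
Definition pd_xy (s : seq 'I_n) (q : nat) (f : base -> K) : base -> K :=
  pds (map Some s ++ nseq q None) f.

End Base.

Section Jets.
Variables (K : numFieldType) (n : nat).

(* The coordinate y_{i_1,...,i_q} is symmetric in its indices, hence it is
   addressed by the multiplicities of 1, ..., n in (i_1,...,i_q); the zero
   multi-index addresses y itself.  Jets carry coordinates of all orders; the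
   operators below only involve finitely many of them. *)
Definition multi_index (s : seq 'I_n) : {ffun 'I_n -> nat} :=
  [ffun j => count_mem j s].

Record jet := Jet { jet_x : 'rV[K]_n; jet_u : {ffun 'I_n -> nat} -> K }.

Definition jet_y (z : jet) (s : seq 'I_n) : K := jet_u z (multi_index s).

Definition jet_base (z : jet) : base K n := (jet_x z, jet_y z [::]).

Definition lift_base (f : base K n -> K) : jet -> K := fun z => f (jet_base z).

Definition jet_dx (i : 'I_n) (F : jet -> K) : jet -> K := fun z =>
  derive1 (fun t : K => F (Jet (jet_x z + t *: delta_mx 0 i) (jet_u z))) 0.

Definition jet_dy (s : seq 'I_n) (F : jet -> K) : jet -> K := fun z =>
  derive1 (fun t : K =>
    F (Jet (jet_x z)
           (fun m => jet_u z m + t * (m == multi_index s)%:R))) 0.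

(* Restricting to nondecreasing tuples counts each jet coordinate of order q
   exactly once; q = 0 gives the term y_i d/dy. *)
Definition total_diff (lambda : nat) (i : 'I_n) (F : jet -> K) : jet -> K :=
  fun z => jet_dx i F z +
    \sum_(q < lambda) \sum_(k : q.-tuple 'I_n | sorted leq (map val k))
      jet_y z (i :: k) * jet_dy k F z.

Section Prolongation.
Variables (X : 'I_n -> base K n -> K) (Y : base K n -> K).

(* The indices are stored in reverse order, last one first. *)
Fixpoint prolong_rev (s : seq 'I_n) : jet -> K :=
  if s is i :: s' then fun z =>
    total_diff (size s').+1 i (prolong_rev s') z -
    \sum_(k < n) total_diff 1 i (lift_base (X k)) z * jet_y z (rcons (rev s') k)
  else lift_base Y.

Definition prolong (s : seq 'I_n) : jet -> K := prolong_rev (rev s).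

End Prolongation.
End Jets.

Section Combinatorics.

Definition kronecker (T : eqType) (s t : seq T) : nat :=
  (\prod_(ab <- zip s t) (ab.1 == ab.2))%N.

(* For q = 0 and q = p the two monotonicity conditions would also single out
   the identity; for q > p the set is empty. *)
Definition shuffles (p q : nat) : {set 'S_p} :=
  if (q == 0)%N || (q == p) then [set 1%g]
  else if (q < p)%N then
    [set t : 'S_p |
      [forall a : 'I_p, forall b : 'I_p,
        (a < b < q)%N || (q <= a < b)%N ==> (t a < t b)%N]]
  else finset.set0.

Section Blocks.
Variables (d a b : nat) (lam : {ffun 'I_d -> 'I_a}) (mu : {ffun 'I_d -> 'I_b}).

Definition weight : nat := (\sum_(e < d) mu e * lam e)%N.

Definition slot_nat (e : 'I_d) (nu g : nat) : nat :=
  (\sum_(e' < d | (e' < e)%N) mu e' * lam e' + nu * lam e + g)%N.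

Lemma slot_subproof (e : 'I_d) (nu : 'I_(mu e)) (g : 'I_(lam e)) :
  (slot_nat e nu g < weight)%N.
Proof.
rewrite /slot_nat /weight [X in (_ < X)%N](bigID (fun e' : 'I_d => (e' < e)%N)) /=.
rewrite -addnA ltn_add2l [X in (_ < X)%N](bigD1 e) ?ltnn //=.
apply: leq_trans (leq_addr _ _).
apply: (@leq_trans (nu.+1 * lam e)); first by rewrite mulSnr ltn_add2l.
by rewrite leq_mul2r (ltn_ord nu) orbT.
Qed.

(* The rank of e:nu:g in the lexicographic list of triples; everything is
   numbered from 0. *)
Definition slot (e : 'I_d) (nu : 'I_(mu e)) (g : 'I_(lam e)) : 'I_weight :=
  Ordinal (slot_subproof nu g).

Definition block (e : 'I_d) (nu : 'I_(mu e)) : {set 'I_weight} :=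
  [set slot nu g | g : 'I_(lam e)].

Definition block_stab : {set 'S_weight} :=
  [set h : 'S_weight | [forall e : 'I_d, forall nu : 'I_(mu e),
     exists nu' : 'I_(mu e), h @: block nu == block nu']].

Lemma block_stab_group_set : group_set block_stab.
Proof.
apply/group_setP; split=> [|g h].
  rewrite inE; apply/forallP=> e; apply/forallP=> nu; apply/existsP; exists nu.
  by rewrite (eq_imset (g := id)) ?imset_id // => j; rewrite perm1.
rewrite !inE => /forallP gP /forallP hP; apply/forallP=> e; apply/forallP=> nu.
have /forallP/(_ nu)/existsP[nu1 /eqP g1] := gP e.
have /forallP/(_ nu1)/existsP[nu2 /eqP h2] := hP e.
apply/existsP; exists nu2; rewrite -h2 -g1 -imset_comp; apply/eqP.
by apply: eq_imset => j; rewrite permM.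
Qed.

Canonical block_stab_group := Group block_stab_group_set.

(* Products of permutations compose from left to right, so the coset
   {h o sigma | h in block_stab} is sigma *: block_stab, a left coset. *)
Definition coset_reps (F : {set 'S_weight}) : Prop :=
  is_transversal F (lcosets block_stab [set: 'S_weight]) [set: 'S_weight].

Lemma coset_reps_exist : exists F : {set 'S_weight}, coset_reps F.
Proof.
eexists; apply: transversalP; apply/and3P; split.
- rewrite finset.eqEsubset finset.subsetT; apply/fintype.subsetP=> x _.
  apply/finset.bigcupP.
  exists (lcoset block_stab x); last by rewrite lcosetE (lcoset_refl block_stab_group).
  by apply/imsetP; exists x; rewrite ?inE.
- apply/finset.trivIsetP=> _ _ /imsetP[x _ ->] /imsetP[y _ ->]; apply: contraR.
  case/pred0Pn=> z /andP[/= zx zy]; apply/eqP; rewrite /= !lcosetE in zx zy *.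
  by rewrite -(lcoset_eqP (G := block_stab_group) zx)
             (lcoset_eqP (G := block_stab_group) zy).
- apply/imsetP=> -[x _ x0]; have := lcoset_refl block_stab_group x.
  by rewrite -lcosetE -x0 inE.
Qed.

End Blocks.
End Combinatorics.

(* Main.v *)
(* Set D_I = D_{i_1} ... D_{i_kappa}. By induction on |I| and the Leibniz rule,
     Y_I = D_I(Y) - sum_k D_I(X^k y_k) + sum_k X^k y_{k,I},
   and D_I of a function of (x, y) is given by the Faa di Bruno formula as a sum
   over the families of disjoint non-empty blocks of positions in I: a block B
   contributes the factor y_B and one y-derivative, a position in no block an
   x-derivative.  For D_I(X^k y_k) one adds the position of k, which has to lie in
   a block; the single block with all positions gives X^k y_{k,I}, which cancels.
   In the closed formula, (lambda, mu) lists the block sizes with their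
   multiplicities, tau selects the positions lying in blocks, and a class of sigma
   modulo the stabilizer of the standard blocks is a partition of these positions
   into blocks of the given sizes; the Kronecker symbols determine the k's. *)

(* The families consist of positions, not of index values, so repetitions among the i's need no care
   and each family enters with coefficient one; the multiplicities hidden in the quotient of the
   symmetric group appear only when families are grouped by block sizes. The analytic part therefore
   only has to match one total differentiation with the insertion of one position. The product X^k
   y_k obeys the same recursion, with the extra position as initial block and the y-order lowered by
   one. Two obstacles shape the rest. The operator D^lambda changes with lambda, so all of them are
   replaced by a single truncation, high enough for the functions in question. And smoothness is
   expressed by iterated partial derivatives, complex ones over [R[i]], so their symmetry has to be
   established first, by restriction to real planes. *)
Require Import Defs.
From HB Require Import structures.
From mathcomp Require Import all_boot all_order all_algebra all_fingroup.
From mathcomp Require Import all_classical all_reals all_analysis.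
From mathcomp Require Import complex ring.

Set Implicit Arguments.
Unset Strict Implicit.
Unset Printing Implicit Defensive.

Import Order.TTheory GRing.Theory Num.Theory numFieldNormedType.Exports.
(* [classical_sets] shadows many lemmas on finite sets. *)
From mathcomp Require Import fintype finset.

Local Open Scope ring_scope.

(** * Partial partitions of a finite set *)

Section PartialPartitions.
Variable T : finType.
Implicit Types (A B C : {set T}) (P : {set {set T}}) (x y : T).

(** The covered set may be any subset of [A], whereas [partition] would prescribe it. *)
Definition ppart A P := [&& trivIset P, set0 \notin P & cover P \subset A].

Lemma trivIset_memP P :
  reflect (forall B C y, B \in P -> C \in P -> y \in B -> y \in C -> B = C)
          (trivIset P).
Proof.
apply: (iffP trivIsetP) => [tP B C y BP CP yB yC|tP B C BP CP].
  apply/eqP/negPn/negP => /(tP _ _ BP CP) /pred0P /(_ y) /=.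
  by rewrite yB yC.
apply: contraR => /pred0Pn[y /andP[/= yB yC]].
by apply/eqP; apply: (tP _ _ y).
Qed.

Lemma ppartP A P :
  reflect [/\ forall B C y, B \in P -> C \in P -> y \in B -> y \in C -> B = C,
              forall B, B \in P -> exists y, y \in B
            & forall B y, B \in P -> y \in B -> y \in A]
          (ppart A P).
Proof.
apply: (iffP and3P) => [[/trivIset_memP tP P0 /subsetP cP]|[tP P0 cP]].
  split=> // [B BP|B y BP yB].
    by apply/set0Pn; apply: contraNneq P0 => <-.
  by apply: cP; apply/bigcupP; exists B.
split; first exact/trivIset_memP.
  by apply/negP => /P0[y]; rewrite inE.
by apply/subsetP => y /bigcupP[B BP yB]; apply: cP yB.
Qed.

(* [ins x] adds the point [x] to the block [p.2] of [p.1], [del x] removes [x]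
   from its block and remembers the rest of that block. *)
Let ins x (p : {set {set T}} * {set T}) := (x |: p.2) |: (p.1 :\ p.2).
Let del x P :=
  let B := pblock P x in ((B :\ x) |: (P :\ B), B :\ x).

(** Since [[set x]] is not a block, the block of x stays non-empty when x is removed; by
    disjointness it then differs from all other blocks, so no block is lost and adding x back
    restores [P]. *)
Lemma del_spec x A P : x \notin A -> ppart (x |: A) P -> x \in cover P ->
    [set x] \notin P ->
  [/\ ins x (del x P) = P, ppart A (del x P).1 & (del x P).2 \in (del x P).1].
Proof.
move=> xA pP xP x1; have /ppartP[tP P0 PA] := pP.
have [BP xB] : pblock P x \in P /\ x \in pblock P x.
  by rewrite mem_pblock pblock_mem.
rewrite /del /ins /=; move: (pblock P x) BP xB => B BP xB.
have [y yB] : exists y, y \in B :\ x.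
  apply/set0Pn; apply: contraNneq x1 => /(congr1 (setU [set x])).
  by rewrite setD1K // setU0 => <-.
have nB : B :\ x \notin P :\ B.
  apply/negP; rewrite in_setD1 => /andP[/eqP ne BxP]; apply: ne.
  by apply: (tP _ _ y) => //; move: yB; rewrite inE => /andP[].
split; last by rewrite setU11.
  by rewrite setD1K // setU1K // setD1K.
apply/ppartP; split.
- move=> C D z; rewrite !inE.
  case/orP=> [/eqP->|/andP[CB CP]]; case/orP=> [/eqP->|/andP[DB DP]] // zC zD.
  + case/eqP: DB; apply: (tP _ _ z) => //.
    by move: zC; rewrite inE => /andP[].
  + case/eqP: CB; apply: (tP _ _ z) => //.
    by move: zD; rewrite inE => /andP[].
  + exact: (tP _ _ z).
- move=> C; rewrite !inE => /orP[/eqP->|/andP[_ /P0 //]].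
  by exists y.
- move=> C z; rewrite !inE => /orP[/eqP->|/andP[CB CP]].
    rewrite !inE => /andP[zx /(PA _ _ BP)]; rewrite !inE.
    by rewrite (negbTE zx).
  move=> zC; have := PA _ _ CP zC; rewrite !inE => /orP[/eqP zx|//].
  by case/eqP: CB; apply: (tP _ _ x) => //; rewrite -zx.
Qed.

(** Together with [del_spec] this is a bijection between the families in which x shares its block
    with other points and the pairs of a family on [A] and one of its blocks. *)
Lemma ins_spec x A P B : x \notin A -> ppart A P -> B \in P ->
  [/\ ppart (x |: A) (ins x (P, B)), x \in cover (ins x (P, B)),
      [set x] \notin ins x (P, B) & del x (ins x (P, B)) = (P, B)].
Proof.
move=> xA pP BP; have /ppartP[tP P0 PA] := pP.
have xN C : C \in P -> x \notin C.
  by move=> CP; apply: contra xA => /(PA _ _ CP).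
have pI : ppart (x |: A) (ins x (P, B)).
  apply/ppartP; split.
  - move=> C D z; rewrite !inE /=.
    case/orP=> [/eqP->|/andP[CB CP]]; case/orP=> [/eqP->|/andP[DB DP]] // zC zD.
    + move: zC; rewrite !inE => /orP[/eqP zx|zB].
        by move: (xN _ DP); rewrite -zx zD.
      by case/eqP: DB; apply: (tP _ _ z).
    + move: zD; rewrite !inE => /orP[/eqP zx|zB].
        by move: (xN _ CP); rewrite -zx zC.
      by case/eqP: CB; apply: (tP _ _ z).
    + exact: (tP _ _ z).
  - move=> C; rewrite !inE => /orP[/eqP->|/andP[_ /P0 //]].
    by exists x; rewrite !inE eqxx.
  - move=> C z; rewrite !inE => /orP[/eqP->|/andP[CB CP]].
      by rewrite !inE => /orP[->//|/(PA _ _ BP) ->]; rewrite orbT.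
    by move=> /(PA _ _ CP) ->; rewrite orbT.
have xB : x |: B \in ins x (P, B) by rewrite !inE eqxx.
have xxB : x \in x |: B by rewrite !inE eqxx.
split=> //.
- by apply/bigcupP; exists (x |: B).
- rewrite !inE /= negb_or negb_and; apply/andP; split.
    have [y yB] := P0 _ BP; apply/eqP => /setP /(_ y).
    rewrite !inE yB orbT => /eqP yx.
    by move: (xN _ BP); rewrite -yx yB.
  by apply/orP; right; apply/negP => /xN; rewrite inE eqxx.
- have /and3P[tI _ _] := pI.
  rewrite /del (def_pblock tI xB xxB) setU1K ?xN //.
  rewrite setU1K ?setD1K //.
  rewrite !inE negb_and; apply/orP; right.
  by apply/negP => /xN; rewrite xxB.
Qed.

(** The three summands are the cases of x uncovered, x alone in a block, and x joining a block of
    [P]. In a total differentiation they become an x-derivative, a new factor y_i, and an index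
    added to an old factor. *)
Lemma sum_ppartU1 (V : nmodType) (G : {set {set T}} -> V) x A : x \notin A ->
  \sum_(P | ppart (x |: A) P) G P =
  \sum_(P | ppart A P)
     (G P + G ([set x] |: P) + \sum_(B in P) G ((x |: B) |: (P :\ B))).
Proof.
move=> xA; rewrite (bigID (fun P : {set {set T}} => x \in cover P)) /=.
rewrite [X in X + _](bigID (fun P : {set {set T}} => [set x] \in P)) /=.
rewrite addrC addrA !big_split /=; congr (_ + _ + _).
- apply: eq_bigl => P; apply/andP/idP => [[/ppartP[tP P0 PA] xP]|].
    apply/ppartP; split=> // B y BP yB; have := PA _ _ BP yB.
    rewrite !inE => /orP[/eqP yx|//]; case/negP: xP.
    by apply/bigcupP; exists B => //; rewrite -yx.
  move=> /ppartP[tP P0 PA]; split.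
    by apply/ppartP; split=> // B y BP yB; rewrite !inE (PA B) ?orbT.
  by apply: contra xA => /bigcupP[B BP]; apply: PA.
- rewrite (reindex_onto (fun P => [set x] |: P) (fun P => P :\ [set x])) /=.
    apply: eq_bigl => P; apply/idP/idP.
      case/andP=> /andP[/andP[/ppartP[tP P0 PA] _] _] /eqP PE.
      have xN : [set x] \notin P by rewrite -PE !inE eqxx.
      have PP B : B \in P -> B \in [set x] |: P by rewrite !inE => ->; rewrite orbT.
      apply/ppartP; split.
      + by move=> B C y BP CP; apply: tP; apply: PP.
      + by move=> B BP; apply: P0; apply: PP.
      + move=> B y BP yB; have := PA _ _ (PP _ BP) yB; rewrite !inE.
        case/orP=> [/eqP yx|//]; case/negP: xN.
        suff -> : [set x] = B by [].
        by apply: (tP _ _ x); rewrite ?inE ?eqxx ?BP ?orbT // -yx.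
    move=> /ppartP[tP P0 PA].
    have xN C : C \in P -> x \notin C.
      by move=> CP; apply: contra xA => /(PA _ _ CP).
    rewrite setU1K ?eqxx ?andbT; last first.
      by apply/negP => /xN; rewrite inE eqxx.
    rewrite setU11 andbT; apply/andP; split; last first.
      by apply/bigcupP; exists [set x]; rewrite ?inE ?eqxx.
    apply/ppartP; split.
    + move=> B C y; rewrite !inE.
      case/orP=> [/eqP->|BP]; case/orP=> [/eqP->|CP] //; rewrite ?inE.
      * by move=> /eqP-> xC; move: (xN _ CP); rewrite xC.
      * by move=> xB /eqP yx; move: (xN _ BP); rewrite -yx xB.
      * exact: tP.
    + move=> B; rewrite !inE => /orP[/eqP->|/P0//].
      by exists x; rewrite inE.
    + move=> B y; rewrite !inE => /orP[/eqP->|BP]; first by rewrite inE => ->.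
      by move=> /(PA _ _ BP) ->; rewrite orbT.
  by move=> P /andP[_ xP]; rewrite setD1K.
- rewrite pair_big_dep /=.
  rewrite (reindex_onto (ins x) (del x)) /=.
    apply: eq_big => [[P B]|[P B] _] //=; apply/idP/idP.
      case/andP => /andP[/andP[pI xI] xN] /eqP E.
      have [_] := del_spec xA pI xI xN; rewrite E /= => -> ->//.
    by case/andP => pP BP; have [-> -> -> ->] := ins_spec xA pP BP; rewrite eqxx.
  by move=> P /andP[/andP[pI xI] xN]; have [] := del_spec xA pI xI xN.
Qed.

End PartialPartitions.

(** * Shuffles and subsets *)

Section Shuffles.
Variable p : nat.
Implicit Types (t : 'S_p) (C : {set 'I_p}) (s : seq 'I_p).

Let lt_ord := relpre (@nat_of_ord p) ltn.

Lemma sorted_enum_set C : sorted lt_ord (enum C).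
Proof.
rewrite -[enum C]/(seq.filter _ _) -(@enumT (ordinal p)).
apply: sorted_filter => [x y z|]; first exact: ltn_trans.
by rewrite -sorted_map val_enum_ord iota_ltn_sorted.
Qed.

(** A strictly increasing list has no freedom beyond its set of entries; this is why a subset
    determines a shuffle. *)
Lemma sorted_eq_enum s C : sorted lt_ord s -> s =i C -> s = enum C.
Proof.
move=> ss sC; apply: (@irr_sorted_eq _ lt_ord) => //.
- by move=> x y z; apply: ltn_trans.
- by move=> x; apply: ltnn.
- exact: sorted_enum_set.
- by move=> x; rewrite mem_enum sC.
Qed.

(** The one-line notation of [t]. *)
Definition perm_seq t : seq 'I_p := [seq t j | j <- enum 'I_p].

Lemma size_perm_seq t : size (perm_seq t) = p.
Proof. by rewrite size_map size_enum_ord. Qed.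

Lemma uniq_perm_seq t : uniq (perm_seq t).
Proof. by rewrite map_inj_uniq ?enum_uniq //; apply: perm_inj. Qed.

Lemma nth_perm_seq x0 t (j : 'I_p) : nth x0 (perm_seq t) j = t j.
Proof. by rewrite (nth_map x0) ?size_enum_ord // nth_ord_enum. Qed.

Lemma mem_perm_seq t x : x \in perm_seq t.
Proof.
by apply/mapP; exists ((t^-1)%g x); rewrite ?mem_enum ?permKV.
Qed.

Definition head_set q t : {set 'I_p} := [set x in take q (perm_seq t)].

Lemma card_head_set q t : (q <= p)%N -> #|head_set q t| = q.
Proof.
move=> qp; rewrite cardsE; have /card_uniqP -> := take_uniq q (uniq_perm_seq t).
by rewrite size_takel // size_perm_seq.
Qed.

Lemma mem_drop_perm_seq q t x :
  (x \in drop q (perm_seq t)) = (x \in ~: head_set q t).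
Proof.
rewrite !inE; have := mem_perm_seq t x; have := uniq_perm_seq t.
rewrite -{1 2}(cat_take_drop q (perm_seq t)) cat_uniq mem_cat.
case/and3P=> _ /hasPn h _; case xd: (x \in drop _ _) => /=.
  by rewrite (h x).
by rewrite orbF => ->.
Qed.

(** Both parts of the one-line notation are strictly increasing, hence enumerate their sets. For q =
    0 and q = p the only shuffle is the identity, which is increasing throughout. *)
Lemma shufflesE q t : t \in shuffles p q ->
  [/\ (q <= p)%N, take q (perm_seq t) = enum (head_set q t)
    & drop q (perm_seq t) = enum (~: head_set q t)].
Proof.
have P1 : perm_seq 1%g = enum 'I_p.
  by rewrite -[RHS]map_id; apply: eq_map => j; rewrite perm1.
have S1 : sorted lt_ord (perm_seq 1%g).
  rewrite P1 (_ : enum 'I_p = enum [set: 'I_p]) ?sorted_enum_set //.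
  by apply: eq_enum => x; rewrite !inE.
have tr : transitive lt_ord by move=> x y z; apply: ltn_trans.
suff H : t \in shuffles p q -> [/\ (q <= p)%N,
    sorted lt_ord (take q (perm_seq t)) & sorted lt_ord (drop q (perm_seq t))].
  move=> /H[qp s1 s2]; split=> //; apply: sorted_eq_enum => // x.
    by rewrite inE.
  exact: mem_drop_perm_seq.
rewrite /shuffles; case: ifP => [q0p|_].
  move=> /set1P->; split; [|exact: take_sorted|exact: drop_sorted].
  by case/orP: q0p => /eqP->.
case: ifP => // qp; last by rewrite inE.
have x0 : 'I_p by exists q.
rewrite inE => /forallP tm; have {}tm (a b : 'I_p) :
    (a < b < q)%N || (q <= a < b)%N -> (t a < t b)%N.
  by move=> ab; have /forallP /(_ b) /implyP := tm a; apply.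
split; first exact: ltnW.
  apply/(sortedP x0) => j; rewrite size_takel ?size_perm_seq ?(ltnW qp) // => jq.
  rewrite !nth_take 1?(ltnW jq) //; have jp := ltn_trans jq qp.
  have := @nth_perm_seq x0 t (Ordinal (ltnW jp)); rewrite /= => ->.
  have := @nth_perm_seq x0 t (Ordinal jp); rewrite /= => ->.
  by apply: tm; rewrite /= ltnSn jq.
apply/(sortedP x0) => j; rewrite size_drop size_perm_seq => jq.
have jp : (q + j.+1 < p)%N by rewrite -ltn_subRL.
have jp' : (q + j < p)%N by apply: leq_ltn_trans jp; rewrite leq_add2l.
rewrite !nth_drop.
have := @nth_perm_seq x0 t (Ordinal jp'); rewrite /= => ->.
have := @nth_perm_seq x0 t (Ordinal jp); rewrite /= => ->.
by apply: tm; rewrite /= leq_addr ltn_add2l ltnSn orbT.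
Qed.

Lemma head_set_surj q C : #|C| = q ->
  exists2 t, t \in shuffles p q & head_set q t = C.
Proof.
move=> Cq; have qp : (q <= p)%N.
  by rewrite -Cq (leq_trans (max_card _)) // card_ord.
(* At the two extremes [shuffles] contains only the identity, and [C] is empty or full. *)
case q0: (q == 0)%N.
  exists 1%g; first by rewrite /shuffles q0 inE.
  have q0' := eqP q0; rewrite (cards0_eq (etrans Cq q0')).
  by apply: cards0_eq; rewrite card_head_set.
case qE: (q == p).
  exists 1%g; first by rewrite /shuffles qE orbT inE.
  apply/eqP; rewrite eqEcard Cq card_head_set // leqnn andbT.
  suff -> : C = setT by apply: subsetT.
  by apply/eqP; rewrite eqEcard subsetT cardsT card_ord Cq (eqP qE) leqnn.
have {}qp : (q < p)%N by rewrite ltn_neqAle qE.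
have x0 : 'I_p by exists q.
(* The one-line notation of the wanted shuffle. *)
pose s := enum C ++ enum (~: C).
have ss : size s = p by rewrite size_cat -!cardE cardsC card_ord.
have us : uniq s.
  rewrite cat_uniq !enum_uniq andbT /=; apply/hasPn => x.
  by rewrite !mem_enum inE.
have tinj : injective (fun j : 'I_p => nth x0 s j).
  by move=> a b /eqP; rewrite nth_uniq ?ss // => /eqP/val_inj.
have tE : perm_seq (perm tinj) = s.
  rewrite -[RHS](mkseq_nth x0) ss /mkseq -val_enum_ord -map_comp.
  by apply: eq_map => j /=; rewrite permE.
exists (perm tinj); last first.
  apply/setP=> x; rewrite inE tE /s -Cq cardE take_size_cat //.
  by rewrite mem_enum.
rewrite /shuffles q0 qE qp inE; apply/forallP => a; apply/forallP => b; apply/implyP.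
have tr : transitive lt_ord by move=> x y z; apply: ltn_trans.
rewrite !permE /s !nth_cat -cardE Cq => /orP[/andP[ab bq]|/andP[qa ab]].
  rewrite bq (ltn_trans ab bq).
  apply: (@sorted_ltn_nth _ lt_ord tr x0 _ (sorted_enum_set C)) => //;
    by rewrite inE -cardE Cq // (ltn_trans ab bq).
have qb := leq_trans qa (ltnW ab).
rewrite !ltnNge qa qb /= -ltnNge.
have sz j : (j < p)%N -> (q <= j)%N -> (j - q < size (enum (~: C)))%N.
  by move=> jp qj; rewrite -cardE cardsCs setCK Cq card_ord ltn_sub2r.
apply: (@sorted_ltn_nth _ lt_ord tr x0 _ (sorted_enum_set (~: C))).
- exact: sz.
- exact: sz.
- by rewrite ltn_sub2r // (leq_ltn_trans qa ab).
Qed.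

(** A shuffle amounts to the set of its first q values; for q > p both sums are empty. *)
Lemma sum_shuffles (V : nmodType) q (G : seq 'I_p -> seq 'I_p -> V) :
  \sum_(t in shuffles p q) G (take q (perm_seq t)) (drop q (perm_seq t)) =
  \sum_(C : {set 'I_p} | #|C| == q) G (enum C) (enum (~: C)).
Proof.
rewrite [RHS](eq_bigl (mem (head_set q @: shuffles p q))); last first.
  move=> C; apply/eqP/imsetP => [/head_set_surj[t tS <-]|[t /shufflesE[qp _ _] ->]].
    by exists t.
  exact: card_head_set.
rewrite big_imset /=; last first.
  move=> t t' /shufflesE[_ t1 t2] /shufflesE[_ t1' t2'] E.
  have : perm_seq t = perm_seq t'.
    by rewrite -(cat_take_drop q (perm_seq t)) t1 t2 E -t1' -t2' cat_take_drop.
  by move=> tt; apply/permP => j; rewrite -(nth_perm_seq j t) tt nth_perm_seq.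
by apply: eq_bigr => t /shufflesE[_ -> ->].
Qed.

End Shuffles.

(** * Set families under injections, and partitions with equal block sizes *)

Definition block_sizes (T : finType) (P : {set {set T}}) : seq nat :=
  [seq #|B| | B : {set T} <- enum P].

Definition imblocks (T1 T2 : finType) (f : T1 -> T2) (P : {set {set T1}}) :
  {set {set T2}} := [set f @: B | B : {set T1} in P].

Lemma imblocks_comp (T1 T2 T3 : finType) (f : T1 -> T2) (g : T2 -> T3) P :
  imblocks (g \o f) P = imblocks g (imblocks f P).
Proof.
by rewrite /imblocks -imset_comp; apply: eq_imset => B /=; rewrite imset_comp.
Qed.

Lemma eq_imblocks (T1 T2 : finType) (f g : T1 -> T2) P :
  f =1 g -> imblocks f P = imblocks g P.
Proof. by move=> fg; apply: eq_imset => B; apply: eq_imset. Qed.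

Lemma imblocks_id (T : finType) (P : {set {set T}}) : imblocks id P = P.
Proof.
by rewrite /imblocks (eq_imset (g := id)) ?imset_id // => B; rewrite imset_id.
Qed.

Lemma imblocks_inj (T1 T2 : finType) (f : T1 -> T2) :
  injective f -> injective (imblocks f).
Proof. by move=> fI; apply: imset_inj; apply: imset_inj. Qed.

Section PartitionIso.
Variables (T1 T2 : finType) (P1 : {set {set T1}}) (P2 : {set {set T2}}).

Lemma block_sizes_imblocks (f : T1 -> T2) :
  injective f -> perm_eq (block_sizes (imblocks f P1)) (block_sizes P1).
Proof.
move=> fI; have : perm_eq (enum (imblocks f P1))
    [seq f @: B | B : {set T1} <- enum P1].
  apply: uniq_perm; rewrite ?enum_uniq //.
    by rewrite map_inj_uniq ?enum_uniq //; apply: imset_inj.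
  move=> B; rewrite mem_enum; apply/imsetP/mapP => -[C CP ->];
    by exists C; rewrite ?mem_enum // -mem_enum.
move/(perm_map (fun B : {set T2} => #|B|)) => /perm_trans; apply.
by rewrite -map_comp (eq_map (g := fun B : {set T1} => #|B|)) // => B /=;
  rewrite card_imset.
Qed.

Hypotheses (tP1 : partition P1 setT) (tP2 : trivIset P2).
Hypothesis eq_sizes : perm_eq (block_sizes P1) (block_sizes P2).

(** Sort both families by block size: blocks of equal rank then have equal cardinality, and f
    matches the elements of such a pair by their ranks. As [P1] covers its whole type, f is defined
    everywhere; [y0] is the default value of [nth]. *)
Lemma partition_iso (y0 : T2) :
  exists2 f : T1 -> T2, injective f & imblocks f P1 = P2.
Proof.
pose leC (T : finType) (B C : {set T}) := (#|B| <= #|C|)%N.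
pose s1 := sort (@leC T1) (enum P1); pose s2 := sort (@leC T2) (enum P2).
have m1 B : (B \in s1) = (B \in P1) by rewrite mem_sort mem_enum.
have m2 B : (B \in s2) = (B \in P2) by rewrite mem_sort mem_enum.
have u1 : uniq s1 by rewrite sort_uniq enum_uniq.
have u2 : uniq s2 by rewrite sort_uniq enum_uniq.
have E : [seq #|B| | B : {set T1} <- s1] = [seq #|B| | B : {set T2} <- s2].
  apply: (sorted_eq leq_trans anti_leq).
  - by rewrite sorted_map; apply: sort_sorted => B C; apply: leq_total.
  - by rewrite sorted_map; apply: sort_sorted => B C; apply: leq_total.
  - apply: (@perm_trans _ (block_sizes P1)).
      by apply: perm_map; rewrite perm_sort.
    apply: (perm_trans eq_sizes).
    by apply: perm_map; rewrite perm_sym perm_sort.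
have ss : size s1 = size s2 by have /(congr1 size) := E; rewrite !size_map.
pose phi B := nth set0 s2 (index B s1).
have phiP B : B \in P1 -> phi B \in P2.
  by rewrite -m1 -m2 -index_mem => BP; rewrite /phi mem_nth // -ss.
have phiC B : B \in P1 -> #|phi B| = #|B|.
  rewrite -m1 => BP; have := BP; rewrite -index_mem => BP'.
  have := congr1 (nth 0%N ^~ (index B s1)) E.
  by rewrite (nth_map set0) // nth_index // (nth_map set0) -?ss // => ->.
have phiI B C : B \in P1 -> C \in P1 -> phi B = phi C -> B = C.
  rewrite -!m1 => BP CP /eqP; rewrite nth_uniq -?ss ?index_mem // => /eqP ix.
  by rewrite -(nth_index set0 BP) ix nth_index.
have phiS B' : B' \in P2 -> exists2 B, B \in P1 & phi B = B'.
  rewrite -m2 => BP; have := BP; rewrite -index_mem -ss => BP'.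
  exists (nth set0 s1 (index B' s2)); first by rewrite -m1 mem_nth.
  by rewrite /phi index_uniq // nth_index.
have /and3P[/eqP covP1 tI1 _] := tP1.
have pB x : x \in pblock P1 x by rewrite mem_pblock covP1 inE.
have pP x : pblock P1 x \in P1 by rewrite pblock_mem // covP1 inE.
pose f x := nth y0 (enum (phi (pblock P1 x))) (index x (enum (pblock P1 x))).
have fB x : f x \in phi (pblock P1 x).
  by rewrite -mem_enum mem_nth // -cardE phiC // cardE index_mem mem_enum.
have fI : injective f.
  move=> x y fxy; have pxy : pblock P1 x = pblock P1 y.
    apply: phiI => //; apply/eqP/negPn/negP.
    have /trivIsetP tI2 := tP2.
    move=> /(tI2 _ _ (phiP _ (pP x)) (phiP _ (pP y)))/pred0P/(_ (f x)) /=.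
    by rewrite fB fxy fB.
  move: fxy; rewrite /f -pxy => /eqP; rewrite nth_uniq ?enum_uniq //.
  - move=> /eqP ix; have xx : x \in enum (pblock P1 x) by rewrite mem_enum.
    by rewrite -(nth_index x xx) ix nth_index // mem_enum pxy.
  - by rewrite -cardE phiC // cardE index_mem mem_enum.
  - by rewrite -cardE phiC // cardE index_mem mem_enum pxy.
have fim B : B \in P1 -> f @: B = phi B.
  move=> BP; apply/eqP; rewrite eqEcard phiC // card_imset // leqnn andbT.
  apply/subsetP => _ /imsetP[x xB ->].
  by have := fB x; rewrite (def_pblock tI1 BP xB).
exists f => //; apply/setP => B'; apply/imsetP/idP => [[B BP ->]|].
  by rewrite fim // phiP.
by case/phiS => B BP <-; exists B; rewrite ?fim.
Qed.

End PartitionIso.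

Lemma imblocks_partition (T1 T2 : finType) (f : T1 -> T2) P D :
  injective f -> partition P D -> partition (imblocks f P) (f @: D).
Proof.
move=> fI /and3P[/eqP cP /trivIsetP tP P0]; apply/and3P; split.
- apply/eqP/setP => y; apply/bigcupP/imsetP.
    case=> _ /imsetP[B BP ->] /imsetP[x xB ->]; exists x => //.
    by rewrite -cP; apply/bigcupP; exists B.
  case=> x; rewrite -cP => /bigcupP[B BP xB] ->.
  by exists (f @: B); apply: imset_f.
- apply/trivIsetP => _ _ /imsetP[B BP ->] /imsetP[C CP ->] ne.
  apply/pred0P => y /=; apply/negbTE/negP => /andP[/imsetP[x xB ->]].
  rewrite mem_imset // => xC.
  have /(tP _ _ BP CP) /pred0P /(_ x) /= : B != C by apply: contraNneq ne => ->.
  by rewrite xB xC.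
- apply/negP => /imsetP[B BP /esym /eqP]; rewrite imset_eq0 => /eqP B0.
  by rewrite -B0 BP in P0.
Qed.

(** By the two hypotheses on [F] the representatives hit every relabelling of [P0] exactly once; by
    [partition_iso] the relabellings, transported by [iota], are all partitions of its image with
    the same block sizes. Inverses appear because the Kronecker symbols prescribe the composite of k
    with sigma. *)
Lemma sum_imblocks (M : nat) (T : finType) (V : nmodType)
    (P0 : {set {set 'I_M}}) (F : {set 'S_M})
    (iota : 'I_M -> T) (G : {set {set T}} -> V) :
  (0 < M)%N -> partition P0 setT -> injective iota ->
  {in F &, injective (fun s : 'S_M => imblocks (s^-1)%g P0)} ->
  (forall s : 'S_M, exists2 s', s' \in F &
      imblocks (s'^-1)%g P0 = imblocks (s^-1)%g P0) ->
  \sum_(s in F) G (imblocks (iota \o (s^-1)%g) P0) =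
  \sum_(P | partition P (iota @: setT) &&
            perm_eq (block_sizes P) (block_sizes P0)) G P.
Proof.
move=> M0 pP0 iI FI FS.
pose h (s : 'S_M) := imblocks (iota \o (s^-1)%g) P0.
have hI : {in F &, injective h}.
  move=> s s' sF s'F; rewrite /h.
  rewrite (imblocks_comp _ iota) (imblocks_comp (s'^-1)%g iota).
  by move/(imblocks_inj iI); apply: FI.
rewrite -[LHS](big_imset G hI) /=; apply: eq_bigl.
move=> P; apply/imsetP/andP => [[s sF ->]|[pP szP]].
  have sI : injective (iota \o (s^-1)%g) by apply: inj_comp => //; apply: perm_inj.
  split; last exact: block_sizes_imblocks.
  have -> : iota @: setT = (iota \o (s^-1)%g) @: setT.
    apply/setP => y; apply/imsetP/imsetP => -[x _ ->].
      by exists (s x); rewrite ?inE //= permK.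
    by exists ((s^-1)%g x).
  exact: imblocks_partition.
have [f fI fP] : exists2 f : 'I_M -> T, injective f & imblocks f P0 = P.
  apply: partition_iso => //; first by case/and3P: pP.
    by rewrite perm_sym.
  exact: (iota (Ordinal M0)).
(* The images of f and of [iota] are both the cover of [P], so f factors through [iota] and the
   factor is a permutation. *)
have fiota x : f x \in codom iota.
  have : f x \in f @: setT by apply: imset_f.
  have /and3P[/eqP <- _ _] := imblocks_partition fI pP0.
  have /and3P[/eqP + _ _] := pP; rewrite fP => ->.
  by case/imsetP => y _ ->; apply: codom_f.
pose g x := iinv (fiota x).
have gK x : iota (g x) = f x by apply: f_iinv.
have gI : injective g by move=> x y /(congr1 iota); rewrite !gK => /fI.
have [s' s'F s'E] := FS ((perm gI)^-1)%g.
exists s' => //.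
rewrite /h (imblocks_comp (s'^-1)%g iota) s'E invgK -imblocks_comp -fP.
by apply: eq_imblocks => x /=; rewrite permE gK.
Qed.

(** * Standard blocks and cosets of their stabilizer *)

Section SlotBlocks.
Variables (d a b : nat) (lam : {ffun 'I_d -> 'I_a}) (mu : {ffun 'I_d -> 'I_b}).

Definition type_sizes : seq nat :=
  flatten [seq nseq (mu e) (lam e : nat) | e : 'I_d <- index_enum 'I_d].

Lemma count_type_sizes p :
  count p type_sizes = (\sum_(e < d) mu e * p (lam e : nat))%N.
Proof.
rewrite /type_sizes count_flatten sumnE !big_map.
by apply: eq_bigr => e _; rewrite count_nseq mulnC.
Qed.

Lemma size_type_sizes : size type_sizes = (\sum_(e < d) mu e)%N.
Proof.
rewrite -(count_predT type_sizes) count_type_sizes.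
by apply: eq_bigr => e _; rewrite muln1.
Qed.

Lemma sumn_type_sizes : sumn type_sizes = weight lam mu.
Proof.
rewrite /type_sizes sumn_flatten sumnE !big_map.
by apply: eq_bigr => e _; rewrite sumn_nseq mulnC.
Qed.

(** Slots of a smaller [e] all come before those of a larger one; for a fixed [e], [nu] and [g] are
    quotient and remainder on division by [lam e], up to an offset. *)
Lemma slot_nat_inj (e e' : 'I_d) nu nu' g g' :
  (nu < mu e)%N -> (g < lam e)%N -> (nu' < mu e')%N -> (g' < lam e')%N ->
  slot_nat lam mu e nu g = slot_nat lam mu e' nu' g' ->
  [/\ e = e', nu = nu' & g = g'].
Proof.
have lt_slot (i j : 'I_d) x y x' y' : (x < mu i)%N -> (y < lam i)%N ->
    (i < j)%N -> (slot_nat lam mu i x y < slot_nat lam mu j x' y')%N.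
  move=> xi yi ij; rewrite /slot_nat -!addnA.
  apply: (@leq_trans (\sum_(e'' < d | (e'' < j)%N) mu e'' * lam e'')); last first.
    exact: leq_addr.
  rewrite [X in (_ < X)%N](bigID (fun e'' : 'I_d => (e'' < i)%N)) /=.
  rewrite [X in (_ < X + _)%N](eq_bigl (fun e'' : 'I_d => (e'' < i)%N)); last first.
    by move=> k /=; case ki: (k < i)%N; rewrite ?andbF // (ltn_trans ki ij).
  rewrite ltn_add2l (bigD1 i) ?ltnn ?ij //=.
  apply: leq_trans (leq_addr _ _).
  apply: (@leq_trans (x.+1 * lam i)); first by rewrite mulSnr ltn_add2l.
  by rewrite leq_mul2r xi orbT.
move=> nue ge nue' ge' E.
have ee' : e = e'.
  apply/val_inj/eqP; rewrite eqn_leq (leqNgt e) (leqNgt e').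
  apply/andP; split; apply/negP.
    move=> e'e; have := lt_slot e' e nu' g' nu g nue' ge' e'e.
    by rewrite E ltnn.
  move=> e'e; have := lt_slot e e' nu g nu' g' nue ge e'e.
  by rewrite E ltnn.
move: nue' ge' E; rewrite -ee' /slot_nat -!addnA => nue' ge' /addnI E.
have l0 : (0 < lam e)%N by apply: leq_ltn_trans ge.
split=> //.
  have := congr1 (fun x => (x %/ lam e)%N) E.
  by rewrite !divnMDl // !divn_small // !addn0.
have := congr1 (fun x => (x %% lam e)%N) E.
by rewrite !modnMDl !modn_small.
Qed.

Lemma slot_inj (e : 'I_d) (nu : 'I_(mu e)) : injective (@slot _ _ _ lam mu e nu).
Proof.
move=> g g' /(congr1 val) /= E; apply: val_inj.
by have [] := slot_nat_inj (ltn_ord nu) (ltn_ord g) (ltn_ord nu) (ltn_ord g') E.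
Qed.

Lemma card_block (e : 'I_d) (nu : 'I_(mu e)) : #|block lam nu| = lam e.
Proof. by rewrite card_imset ?card_ord //; apply: slot_inj. Qed.

Let blk (u : {e : 'I_d & 'I_(mu e)}) := block lam (tagged u).

Definition slot_blocks : {set {set 'I_(weight lam mu)}} :=
  [set blk u | u in {: {e : 'I_d & 'I_(mu e)}}].

Lemma mem_slot_blocks (e : 'I_d) (nu : 'I_(mu e)) :
  block lam nu \in slot_blocks.
Proof. by apply/imsetP; exists (existT _ e nu). Qed.

Lemma slot_blocksP B :
  reflect (exists e : 'I_d, exists nu : 'I_(mu e), B = block lam nu)
          (B \in slot_blocks).
Proof.
apply: (iffP imsetP) => [[[e nu] _ ->]|[e [nu ->]]]; first by exists e, nu.
by exists (existT _ e nu).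
Qed.

Lemma blk_meet u v x : x \in blk u -> x \in blk v -> u = v.
Proof.
case: u v => [e nu] [e' nu'] /imsetP[g _ ->] /imsetP[g' _ /(congr1 val) /= E].
have [ee nn _] := slot_nat_inj (ltn_ord nu) (ltn_ord g) (ltn_ord nu') (ltn_ord g') E.
by subst e'; congr existT; apply: val_inj.
Qed.

Hypothesis lam_gt0 : forall e, (0 < lam e)%N.

Lemma blk_inj : injective blk.
Proof.
move=> u v uv; have : (0 < #|blk u|)%N by rewrite card_block.
by case/card_gt0P => x xu; apply: (blk_meet xu); rewrite -uv.
Qed.

(** Positive sizes make the blocks pairwise distinct as sets, whereas empty blocks would coincide;
    so no index pair is lost in the set of blocks. *)
Lemma big_slot_blocks (V : Type) (idx : V) (op : Monoid.com_law idx) f :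
  \big[op/idx]_(B in slot_blocks) f B =
  \big[op/idx]_(e < d) \big[op/idx]_(nu < mu e) f (block lam nu).
Proof.
rewrite big_imset /=; last by move=> u v _ _; apply: blk_inj.
by rewrite sig_big_dep.
Qed.

Lemma slot_blocks_partition : partition slot_blocks setT.
Proof.
have tI : trivIset slot_blocks.
  apply/trivIsetP => _ _ /imsetP[u _ ->] /imsetP[v _ ->] ne.
  apply/pred0P => x /=; apply/negbTE/negP => /andP[xu xv].
  by case/eqP: ne; rewrite (blk_meet xu xv).
apply/and3P; split => //.
  (* The blocks are disjoint and their sizes add up to the weight, so they cover everything. *)
  rewrite eqEcard subsetT cardsT card_ord -(eqP tI) big_slot_blocks.
  apply/eq_leq/eq_bigr => e _; rewrite -[in LHS](card_ord (mu e)) -sum_nat_const.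
  by apply: eq_bigr => nu _; rewrite card_block.
apply/negP => /slot_blocksP[e [nu /esym/eqP]].
by rewrite -cards_eq0 card_block eqn0Ngt lam_gt0.
Qed.

Lemma block_sizes_slot_blocks : perm_eq (block_sizes slot_blocks) type_sizes.
Proof.
apply/seq.permP => p; rewrite count_type_sizes count_map -sum1_count big_enum_cond /=.
rewrite big_mkcondr big_slot_blocks; apply: eq_bigr => e _.
rewrite (eq_bigr (fun=> nat_of_bool (p (lam e : nat)))) => [|nu _].
  by rewrite sum_nat_const card_ord.
by rewrite card_block; case: (p _).
Qed.

Hypothesis lam_inj : injective lam.

(** The stabilizer sends a block to a block with the same [e]. Different [e] have different sizes
    and h preserves cardinality, so it is enough that h permutes the set of all blocks. *)
Lemma imblocks_stab (h : 'S_(weight lam mu)) :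
  (h \in block_stab lam mu) = (imblocks h slot_blocks == slot_blocks).
Proof.
rewrite inE; apply/forallP/eqP => [hs|hE e].
  have hI := imset_inj (@perm_inj _ h).
  apply/eqP; rewrite eqEcard (card_imset slot_blocks hI) leqnn andbT.
  apply/subsetP => _ /imsetP[_ /slot_blocksP[e [nu ->]] ->].
  by have /forallP/(_ nu)/existsP[nu' /eqP->] := hs e; apply: mem_slot_blocks.
apply/forallP => nu; have : h @: block lam nu \in slot_blocks.
  by rewrite -hE; apply: imset_f; apply: mem_slot_blocks.
case/slot_blocksP => e' [nu' E].
have ee : e = e'.
  apply/lam_inj/val_inj; rewrite /= -(card_block nu) -(card_block nu') -E card_imset //.
  exact: perm_inj.
by subst e'; apply/existsP; exists nu'; rewrite E.
Qed.

(** The product of [s^-1] and [s'] applies [s^-1] first; it preserves the standard blocks exactly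
    when [s^-1] and [s'^-1] send them to the same family. So cosets correspond to relabelled
    families. *)
Lemma imblocks_coset (s s' : 'S_(weight lam mu)) :
  (s' \in s *: block_stab lam mu)%g =
  (imblocks (s'^-1)%g slot_blocks == imblocks (s^-1)%g slot_blocks).
Proof.
have E1 : imblocks s' (imblocks (s'^-1)%g slot_blocks) = slot_blocks.
  rewrite -imblocks_comp -[RHS]imblocks_id.
  by apply: eq_imblocks => x /=; rewrite permKV.
have E2 : imblocks (s^-1 * s')%g slot_blocks =
    imblocks s' (imblocks (s^-1)%g slot_blocks).
  by rewrite -imblocks_comp; apply: eq_imblocks => x /=; rewrite permM.
rewrite mem_lcoset imblocks_stab E2 -[X in _ == X]E1.
by rewrite (inj_eq (imblocks_inj (@perm_inj _ s'))) eq_sym.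
Qed.

Variables (F : {set 'S_(weight lam mu)}) (F_reps : coset_reps F).

(** A transversal meets each coset exactly once: uniqueness gives injectivity here, existence gives
    [coset_reps_surj]. *)
Lemma coset_reps_inj :
  {in F &, injective (fun s : 'S_(weight lam mu) => imblocks (s^-1)%g slot_blocks)}.
Proof.
move=> s s' sF s'F /eqP; rewrite eq_sym -imblocks_coset => ss'.
have /and3P[_ _ /forallP /(_ (s *: block_stab lam mu)%g)] := F_reps.
have -> : (s *: block_stab lam mu \in lcosets (block_stab lam mu) setT)%g.
  by apply/imsetP; exists s; rewrite ?inE // lcosetE.
case/cards1P => r rE; have : s \in [set r] /\ s' \in [set r].
  by rewrite -rE !(inE, sF, s'F) ss' (lcoset_refl (block_stab_group lam mu)).
by rewrite !inE => -[/eqP-> /eqP->].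
Qed.

Lemma coset_reps_surj (s : 'S_(weight lam mu)) : exists2 s', s' \in F &
  imblocks (s'^-1)%g slot_blocks = imblocks (s^-1)%g slot_blocks.
Proof.
have /and3P[_ _ /forallP /(_ (s *: block_stab lam mu)%g)] := F_reps.
have -> : (s *: block_stab lam mu \in lcosets (block_stab lam mu) setT)%g.
  by apply/imsetP; exists s; rewrite ?inE // lcosetE.
case/cards1P => r rE; have : r \in [set r] by rewrite inE.
rewrite -rE inE => /andP[rF]; rewrite imblocks_coset => /eqP E.
by exists r.
Qed.

End SlotBlocks.

(** * Block sizes *)

Section SumTypes.
Variables (kappa : nat) (s : seq nat).
Hypothesis s_nil : s != [::].
Hypothesis s_bounds : forall m, m \in s -> (0 < m <= kappa)%N.
Hypothesis s_sum : (sumn s <= kappa.+1)%N.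

Let valid_lam d (lam : {ffun 'I_d -> 'I_kappa.+1}) :=
  [forall e : 'I_d, 1 <= lam e]%N &&
  [forall e : 'I_d, forall e' : 'I_d, (e < e') ==> (lam e < lam e')]%N.

Let valid_mu d (lam : {ffun 'I_d -> 'I_kappa.+1}) (mu : {ffun 'I_d -> 'I_kappa.+2}) :=
  [forall e : 'I_d, 1 <= mu e]%N && (weight lam mu <= kappa.+1)%N.

Lemma increasing_inj d (lam : {ffun 'I_d -> 'I_kappa.+1}) :
  [forall e : 'I_d, forall e' : 'I_d, (e < e') ==> (lam e < lam e')]%N ->
  injective lam.
Proof.
move=> /forallP lt_lam; have {}lt_lam (e e' : 'I_d) : (e < e')%N -> (lam e < lam e')%N.
  by move=> ee'; have /forallP/(_ e')/implyP := lt_lam e; apply.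
move=> e e' E; apply/val_inj/eqP; rewrite eqn_leq (leqNgt e) (leqNgt e').
by apply/andP; split; apply/negP => /lt_lam; rewrite E ltnn.
Qed.

Lemma count_mem_type_sizes d (lam : {ffun 'I_d -> 'I_kappa.+1})
    (mu : {ffun 'I_d -> 'I_kappa.+2}) e :
  injective lam -> count_mem (lam e : nat) (type_sizes lam mu) = mu e.
Proof.
move=> lamI; rewrite count_type_sizes (bigD1 e) //= eqxx muln1 big1 ?addn0 //.
move=> e' ne; case: eqP => [/val_inj/lamI E|]; last by rewrite muln0.
by rewrite E eqxx in ne.
Qed.

Let u := sort leq (undup s).

Let u_sorted : sorted ltn u.
Proof.
by rewrite ltn_sorted_uniq_leq sort_uniq undup_uniq (sort_sorted leq_total).
Qed.

Let mem_u m : (m \in u) = (m \in s).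
Proof. by rewrite mem_sort mem_undup. Qed.

Let lam_vals d (lam : {ffun 'I_d -> 'I_kappa.+1}) := 
  [seq nat_of_ord (lam e) | e : 'I_d <- enum 'I_d].

Let lam_valsE d (lam : {ffun 'I_d -> 'I_kappa.+1}) mu :
  valid_lam lam -> valid_mu lam mu -> perm_eq s (type_sizes lam mu) ->
  lam_vals lam = u.
Proof.
move=> /andP[/forallP lam_gt0 lam_incr] /andP[/forallP mu_gt0 _] sE.
apply: (irr_sorted_eq ltn_trans ltnn) => //.
  apply: (homo_sorted (e := relpre val ltn)) => [e e' ee'|].
    by have /forallP/(_ e)/forallP/(_ e')/implyP := lam_incr; apply.
  by rewrite -sorted_map val_enum_ord iota_ltn_sorted.
move=> m; rewrite mem_u (perm_mem sE); apply/mapP/idP => [[e _ ->]|].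
  rewrite -has_pred1 has_count count_mem_type_sizes ?mu_gt0 //.
  exact: increasing_inj.
case/flattenP => _ /mapP[e _ ->]; rewrite mem_nseq => /andP[_ /eqP->].
by exists e; rewrite ?mem_enum.
Qed.

(** Only one triple of d, [lam] and [mu] describes the multiset [s]: [lam] has to list its distinct
    values in increasing order and [mu] their multiplicities. *)
Lemma sum_types (V : nmodType) (v : V) :
  \sum_(1 <= d < kappa.+2)
  \sum_(lam : {ffun 'I_d -> 'I_kappa.+1} |
          [forall e : 'I_d, 1 <= lam e]%N &&
          [forall e : 'I_d, forall e' : 'I_d, (e < e') ==> (lam e < lam e')]%N)
  \sum_(mu : {ffun 'I_d -> 'I_kappa.+2} |
          [forall e : 'I_d, 1 <= mu e]%N && (weight lam mu <= kappa.+1)%N)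
    (if perm_eq s (type_sizes lam mu) then v else 0) = v.
Proof.
(* The parts are positive, so their number is bounded by their sum; this puts d and the
   multiplicities within the ranges of summation. *)
have s_size : (size s <= sumn s)%N.
  rewrite sumnE -sum1_size !big_seq leq_sum // => m ms.
  by have /andP[] := s_bounds ms.
have count_le m : (count_mem m s < kappa.+2)%N.
  exact: leq_ltn_trans (count_size _ _) (leq_ltn_trans s_size _).
have u_le e : (e < size u)%N -> (0 < nth 0%N u e <= kappa)%N.
  by move=> eu; apply: s_bounds; rewrite -mem_u mem_nth.
pose d0 := size u.
have d0_in : d0 \in index_iota 1 kappa.+2.
  rewrite mem_index_iota lt0n size_eq0; apply/andP; split.
    apply: contraNneq s_nil => u0; case: (s) mem_u => // m t /(_ m).
    by rewrite u0 !inE eqxx.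
  rewrite ltnS (leq_trans _ s_sum) // (leq_trans _ s_size) //.
  by rewrite /d0 /u size_sort size_undup.
rewrite (bigD1_seq d0) ?iota_uniq //= [X in _ + X]big1 ?addr0; last first.
  move=> d dd0; apply: big1 => lam lamV; apply: big1 => mu muV.
  case: ifP => // sE; have /(congr1 size) := lam_valsE lamV muV sE.
  by rewrite size_map size_enum_ord => dE; rewrite dE eqxx in dd0.
pose lam0 : {ffun 'I_d0 -> 'I_kappa.+1} := [ffun e : 'I_d0 => inord (nth 0%N u e)].
have lam0E e : lam0 e = nth 0%N u e :> nat.
  by rewrite ffunE inordK // ltnS; have /andP[] := u_le _ (ltn_ord e).
have lam0V : valid_lam lam0.
  apply/andP; split; apply/forallP => e.
    by rewrite lam0E; have /andP[] := u_le _ (ltn_ord e).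
  apply/forallP => e'; apply/implyP => ee'; rewrite !lam0E.
  by apply: (sorted_ltn_nth ltn_trans 0%N u_sorted) => //; apply: ltn_ord.
have lam0I := increasing_inj (proj2 (andP lam0V)).
pose mu0 : {ffun 'I_d0 -> 'I_kappa.+2} :=
  [ffun e : 'I_d0 => inord (count_mem (lam0 e : nat) s)].
have mu0E e : mu0 e = count_mem (lam0 e : nat) s :> nat.
  by rewrite ffunE inordK.
have sE0 : perm_eq s (type_sizes lam0 mu0).
  apply/allP => m _ /=; rewrite count_type_sizes.
  have [ms|ms] := boolP (m \in u).
    have mi : (index m u < d0)%N by rewrite index_mem.
    have lm : lam0 (Ordinal mi) = m :> nat by rewrite lam0E nth_index.
    rewrite (bigD1 (Ordinal mi)) //= lm eqxx muln1 mu0E lm big1 ?addn0 // => e ne.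
    case: eqP => [E|]; last by rewrite muln0.
    by case/eqP: ne; apply/lam0I/val_inj; rewrite /= E lm.
  rewrite big1 => [|e _ /=].
    by apply/eqP/count_memPn; rewrite -mem_u.
  case: eqP => [E|]; last by rewrite muln0.
  by move: ms; rewrite -E lam0E mem_nth.
have mu0V : valid_mu lam0 mu0.
  apply/andP; split; last by rewrite -sumn_type_sizes -(perm_sumn sE0).
  apply/forallP => e; rewrite mu0E -has_count has_pred1 -mem_u lam0E.
  by rewrite mem_nth.
rewrite (bigD1 lam0) //= [X in _ + X]big1 ?addr0; last first.
  move=> lam /andP[lamV ne]; apply: big1 => mu muV; case: ifP => // sE.
  have E := lam_valsE lamV muV sE.
  case/eqP: ne; apply/ffunP => e; apply: val_inj; rewrite /= lam0E -E.
  by rewrite (nth_map e) ?size_enum_ord // nth_ord_enum.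
rewrite (bigD1 mu0) //= sE0 [X in _ + X]big1 ?addr0 // => mu /andP[muV ne].
case: ifP => // sE; case/eqP: ne; apply/ffunP => e; apply: val_inj.
by rewrite /= mu0E (seq.permP sE) count_mem_type_sizes.
Qed.

End SumTypes.

(** * Symmetry of mixed partial derivatives *)

Section RealSchwarz.
Variable R : realType.

(** The mean value theorem is applied to the increment in t as a function of s, then to [g1 s] as a
    function of t. *)
Lemma second_difference (g g1 g12 : R -> R -> R) (h : R) : 0 < h ->
  (forall s t : R, is_derive s 1 (fun s => g s t) (g1 s t)) ->
  (forall s t : R, is_derive t 1 (g1 s) (g12 s t)) ->
  exists s t : R, [/\ 0 < s < h, 0 < t < h &
    g h h - g 0 h - g h 0 + g 0 0 = g12 s t * h * h].
Proof.
move=> h0 D1 D12.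
have D (s : R) : is_derive s 1 (fun s => g s h - g s 0) (g1 s h - g1 s 0).
  exact: is_deriveB.
have [|s sh E1] :=
    @MVT R (fun s => g s h - g s 0) (fun s => g1 s h - g1 s 0) 0 h h0.
  by apply: derivable_within_continuous => x _; case: (D x).
have [|t th E2] := @MVT R (g1 s) (g12 s) 0 h h0.
  by apply: derivable_within_continuous => x _; case: (D12 s x).
exists s, t; split; [by rewrite in_itv in sh|by rewrite in_itv in th|].
move: E1; rewrite E2 !subr0 => <-.
by ring.
Qed.

(** The second difference, computed in both orders, is h^2 times a value of [g12] and h^2 times a
    value of [g21] in the open square of side h; continuity at the origin then excludes any gap
    between the two derivatives. *)
Lemma schwarz_real (g g1 g2 g12 g21 : R -> R -> R) :
  (forall s t : R, is_derive s 1 (fun s => g s t) (g1 s t)) ->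
  (forall s t : R, is_derive t 1 (g1 s) (g12 s t)) ->
  (forall s t : R, is_derive t 1 (g s) (g2 s t)) ->
  (forall s t : R, is_derive s 1 (fun s => g2 s t) (g21 s t)) ->
  (forall e, 0 < e -> exists2 r : R, 0 < r &
     forall s t, `|s| < r -> `|t| < r -> `|g12 0 0 - g12 s t| < e) ->
  (forall e, 0 < e -> exists2 r : R, 0 < r &
     forall s t, `|s| < r -> `|t| < r -> `|g21 0 0 - g21 s t| < e) ->
  g12 0 0 = g21 0 0.
Proof.
move=> D1 D12 D2 D21 C12 C21; apply/eqP; rewrite -subr_eq0 -normr_le0 leNgt.
(* Half the supposed gap is allotted to each derivative; through the common value the two estimates
   add up to less than the gap. *)
apply/negP => d0; set e := `|_| in d0; have e0 : 0 < e / 2 by rewrite divr_gt0.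
have [r r0 rP] := C12 _ e0; have [r' r'0 rP'] := C21 _ e0.
pose h := Num.min r r'; have h0 : 0 < h by rewrite lt_min r0.
have [s [t [/andP[s0 sh] /andP[t0 th] E]]] := second_difference h0 D1 D12.
have [t' [s' [/andP[t'0 t'h] /andP[s'0 s'h] E']]] :=
  @second_difference (fun s t => g t s) (fun s t => g2 t s) (fun s t => g21 t s)
    h h0 (fun s t => D2 t s) (fun s t => D21 t s).
have {E E'} E : g12 s t = g21 s' t'.
  have hh : h * h != 0 by rewrite mulf_neq0 // gt_eqF.
  apply: (mulIf hh); rewrite !mulrA -E -E'; by ring.
have lt_r x : 0 < x -> x < h -> `|x| < r /\ `|x| < r'.
  by move=> x0; rewrite lt_min gtr0_norm // => /andP[].
have := rP s t (proj1 (lt_r _ s0 sh)) (proj1 (lt_r _ t0 th)).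
have := rP' s' t' (proj2 (lt_r _ s'0 s'h)) (proj2 (lt_r _ t'0 t'h)).
rewrite distrC -E => lt2 lt1; have := ltrD lt1 lt2; rewrite -splitr ltNge.
by rewrite /e (le_trans _ (ler_normD _ _)) // addrA subrK.
Qed.

End RealSchwarz.

Section Schwarz.
Variables (K : numFieldType) (R : realType) (j : {rmorphism R -> K}) (rho : K -> R).
Hypothesis j_lt : forall x y, (j x < j y) = (x < y).
Hypothesis j_norm : forall x, `|j x| = j `|x|.
Hypothesis j_cofinal : forall e, 0 < e -> exists2 r, 0 < r & j r <= e.
Hypothesis rhoB : forall x y, rho (x - y) = rho x - rho y.
Hypothesis rhoZ : forall r x, rho (j r * x) = r * rho x.
Hypothesis rho_le : forall x, j `|rho x| <= `|x|.

(** [rho] is a real-linear functional of norm at most one: the identity, or the real or imaginary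
    part. It maps the difference quotient over K at [j h] to the real one at h without increasing
    distances, and [j_cofinal] turns a radius in K into a real one. *)
Lemma is_derive_restrict (V : normedModType K) (f : V -> K) (b v : V) (s : R) :
  derivable f (b + j s *: v) v ->
  is_derive s 1 (fun s : R => rho (f (b + j s *: v))) (rho ('D_v f (b + j s *: v))).
Proof.
move=> fd.
suff H : ((fun h : R =>
    h^-1 *: (((fun s : R => rho (f (b + j s *: v))) \o shift s) (h *: 1)
    - rho (f (b + j s *: v)))) @ 0^' --> rho ('D_v f (b + j s *: v)))%classic.
  apply: DeriveDef; first by apply: cvgP H.
  exact: cvg_lim H.
apply/cvgrPdist_lt => e e0; have je0 : 0 < j e by rewrite -(rmorph0 j) j_lt.
have /cvgrPdist_lt /(_ _ je0) := fd.
move=> /nbhs_ballP[d /= d0 dP].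
have [r r0 rd] := j_cofinal d0.
apply/nbhs_ballP; exists r => //= h; rewrite /ball /= sub0r normrN => hr h0.
have jh0 : j h != 0 by rewrite fmorph_eq0.
have := dP (j h); rewrite /ball /= sub0r normrN j_norm => /(_ _ jh0).
move=> dPh; rewrite -j_lt; apply: le_lt_trans (dPh _); last first.
  by apply: lt_le_trans rd; rewrite j_lt.
refine (le_trans _ (rho_le _)); rewrite le_eqVlt; apply/orP; left; apply/eqP.
congr (j `|_|); rewrite rhoB -fmorphV rhoZ rhoB.
congr (_ - _ * (rho (f _) - _)).
rewrite /= (_ : h *: (1 : R) = h); last exact: mulr1.
by rewrite rmorphD scalerDl addrCA.
Qed.

Variable n : nat.

Lemma continuous_restrict (F : base K n -> K) (a v w : base K n) :
  continuous F -> forall e, 0 < e -> exists2 r : R, 0 < r &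
     forall s t, `|s| < r -> `|t| < r ->
       `|rho (F a) - rho (F (a + j s *: v + j t *: w))| < e.
Proof.
move=> Fc e e0; have je0 : 0 < j e by rewrite -(rmorph0 j) j_lt.
have /cvgrPdist_lt /(_ _ je0) := Fc a.
move/nbhs_normP => [d /= d0 dP].
(* The summand 1 makes the divisor positive for all directions and the last estimate strict. *)
have c0 : 0 < `|v| + `|w| + 1 by rewrite ltr_wpDl // addr_ge0.
have [r r0 rd] := j_cofinal (divr_gt0 d0 c0).
exists r => // s t sr tr; rewrite -j_lt -rhoB; apply: le_lt_trans (rho_le _) _.
apply: dP => /=; rewrite -!addrA opprD addNKr normrN.
apply: le_lt_trans (ler_normD _ _) _; rewrite !normrZ !j_norm.
apply: (@le_lt_trans _ _ (j r * (`|v| + `|w|))).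
  by rewrite mulrDr lerD // ler_wpM2r // ltW // j_lt.
apply: (@lt_le_trans _ _ (j r * (`|v| + `|w| + 1))).
  by rewrite ltr_pM2l ?ltrDl // -(rmorph0 j) j_lt.
by rewrite -ler_pdivlMr.
Qed.

(* A derivative over [K] restricts to a derivative along the image of [R], so the
   real theorem applies to the components [rho] of f on a real plane. *)
Lemma schwarz_restrict (f : base K n -> K) (c1 c2 : option 'I_n) (a : base K n) :
  smooth f -> rho (pd c2 (pd c1 f) a) = rho (pd c1 (pd c2 f) a).
Proof.
move=> fs; pose v : base K n := base_dir K c1; pose w : base K n := base_dir K c2.
have D s c b : derivable (pds s f) b (base_dir K c) by case: (fs s).
pose at_ (F : base K n -> K) (s t : R) := rho (F (a + j s *: v + j t *: w)).
have DA F (s t : R) : (forall b, derivable F b v) ->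
    is_derive s 1 (fun s => at_ F s t) (at_ (fun b => 'D_v F b) s t).
  move=> FD; rewrite /at_; under eq_fun do rewrite addrAC.
  by rewrite addrAC; apply: is_derive_restrict.
have DB F (s t : R) : (forall b, derivable F b w) ->
    is_derive t 1 (at_ F s) (at_ (fun b => 'D_w F b) s t).
  by move=> FD; apply: is_derive_restrict.
have at0 F : at_ F 0 0 = rho (F a) by rewrite /at_ rmorph0 !scale0r !addr0.
refine (etrans (esym (at0 (pd c2 (pd c1 f))))
  (etrans _ (at0 (pd c1 (pd c2 f))))).
have D1 (s t : R) : is_derive s 1 (fun s => at_ f s t) (at_ (pd c1 f) s t).
  by apply: DA; apply: (D [::]).
have D12 (s t : R) : is_derive t 1 (at_ (pd c1 f) s) (at_ (pd c2 (pd c1 f)) s t).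
  by apply: DB; apply: (D [:: c1]).
have D2 (s t : R) : is_derive t 1 (at_ f s) (at_ (pd c2 f) s t).
  by apply: DB; apply: (D [::]).
have D21 (s t : R) : is_derive s 1 (fun s => at_ (pd c2 f) s t) (at_ (pd c1 (pd c2 f)) s t).
  by apply: DA; apply: (D [:: c2]).
have C F e : continuous F -> 0 < e -> exists2 r : R, 0 < r &
     forall s t, `|s| < r -> `|t| < r -> `|at_ F 0 0 - at_ F s t| < e.
  by move=> Fc e0; rewrite at0; apply: continuous_restrict.
apply: (schwarz_real D1 D12 D2 D21) => e e0; apply: C => //.
  by case: (fs [:: c2; c1]).
by case: (fs [:: c1; c2]).
Qed.

End Schwarz.

(** Over the complex scalars the identity is checked on real and imaginary parts separately. *)
Lemma schwarz (R : realType) (c : scalar_kind) (n : nat)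
    (f : base (scalars R c) n -> scalars R c) (c1 c2 : option 'I_n) :
  smooth f -> pd c2 (pd c1 f) = pd c1 (pd c2 f).
Proof.
move=> fs; apply/funext => a; case: c f fs a => f fs a.
  apply: (@schwarz_restrict _ R idfun idfun _ _ _ _ _ _ _ f) => //.
  by move=> e e0; exists e.
have jn (x : R) : `|real_complex R x| = real_complex R `|x|.
  by rewrite normc_def /= expr0n /= addr0 sqrtr_sqr.
have jcof (e : R[i]) : 0 < e -> exists2 r : R, 0 < r & real_complex R r <= e.
  move=> e0; exists (complex.Re e); first by move: e0; rewrite ltcE => /andP[].
  by rewrite RRe_real // gtr0_real.
have eqC (x y : R[i]) : complex.Re x = complex.Re y ->
    complex.Im x = complex.Im y -> x = y.
  by case: x y => [? ?] [? ?] /= -> ->.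
apply: eqC.
  apply: (@schwarz_restrict R[i] R (real_complex R) (@complex.Re R)) => //.
  - by move=> x y; rewrite ltcR.
  - by case=> ? ? [].
  - by move=> r [x y] /=; rewrite mul0r subr0.
  - exact: normc_ge_Re.
apply: (@schwarz_restrict R[i] R (real_complex R) (@complex.Im R)) => //.
- by move=> x y; rewrite ltcR.
- by case=> ? ? [].
- by move=> r [x y] /=; rewrite mul0r addr0.
- move=> [x y]; rewrite normc_def lecR /= -sqrtr_sqr ler_sqrt ?addr_ge0 ?sqr_ge0 //.
  by rewrite lerDr sqr_ge0.
Qed.

(** * Reordering of iterated partial derivatives *)

Section Derivatives.
Variables (K : numFieldType) (n : nat).
Implicit Types (f : base K n -> K) (s : seq (option 'I_n)).

(** Assumed from here on, so that the jet calculus works over any [numFieldType]; [schwarz] provides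
    it for both kinds of scalars. *)
Definition symmetric_pd := forall f c1 c2,
  smooth f -> pd c2 (pd c1 f) = pd c1 (pd c2 f).

Lemma smooth_pds s f : smooth f -> smooth (pds s f).
Proof. by move=> fs s'; rewrite /pds -foldr_cat; apply: fs. Qed.

Hypothesis pdC : symmetric_pd.

Lemma pds_perm s s' f : smooth f -> perm_eq s s' -> pds s f = pds s' f.
Proof.
move=> fs; have bubble x s1 s2 : pds (s1 ++ x :: s2) f = pd x (pds (s1 ++ s2) f).
  elim: s1 => //= y s1 ->; apply: pdC; exact: smooth_pds.
elim: s s' => [s'|x s IH s' ss']; first by rewrite perm_sym => /perm_nilP ->.
have /path.splitPr E : x \in s' by rewrite -(perm_mem ss') mem_head.
case: E ss' => s1 s2 ss'; rewrite bubble /=; congr (pd x _); apply: IH.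
by rewrite -(perm_cons x) (perm_trans ss') // -[x :: s2]cat1s perm_catCA.
Qed.

Lemma pd_xy_perm (s s' : seq 'I_n) q f : smooth f -> perm_eq s s' ->
  pd_xy s q f = pd_xy s' q f.
Proof. by move=> fs ss'; apply: pds_perm => //; rewrite perm_cat // perm_map. Qed.

Lemma pd_y_xy (s : seq 'I_n) q f : smooth f ->
  pd None (pd_xy s q f) = pd_xy s q.+1 f.
Proof.
move=> fs; rewrite -[LHS]/(pds (None :: _ ++ _) f); apply: pds_perm => //.
by rewrite -[_ :: _]cat1s perm_catCA.
Qed.

End Derivatives.

(** * Differential calculus on jets *)

Section JetCalculus.
Variables (K : numFieldType) (n : nat).
Implicit Types (f : base K n -> K) (F G : jet K n -> K) (z : jet K n) (s : seq 'I_n).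

Lemma multi_index_eq s s' : (multi_index s == multi_index s') = perm_eq s s'.
Proof.
apply/eqP/idP => [/ffunP E|ss'].
  by apply/allP => j _; apply/eqP; have := E j; rewrite !ffunE.
by apply/ffunP => j; rewrite !ffunE; apply/seq.permP.
Qed.

Lemma jet_y_perm z s s' : perm_eq s s' -> jet_y z s = jet_y z s'.
Proof. by rewrite -multi_index_eq /jet_y => /eqP ->. Qed.

(** One type for both kinds of coordinate lines, so that each derivation rule is proved once for x-
    and y-coordinates. *)
Definition jet_shift (v : 'I_n + seq 'I_n) z (t : K) : jet K n :=
  match v with
  | inl i => Jet (jet_x z + t *: delta_mx 0 i) (jet_u z)
  | inr s => Jet (jet_x z) (fun m => jet_u z m + t * (m == multi_index s)%:R)
  end.

Lemma jet_shift0 v z : jet_shift v z 0 = z.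
Proof.
case: v z => [i|s] [x u] /=; first by rewrite scale0r addr0.
by congr Jet; apply/funext => m; rewrite mul0r addr0.
Qed.

Definition jet_d v F z : K := derive1 (fun t : K => F (jet_shift v z t)) 0.

Definition jet_derivable F :=
  forall v z, derivable (fun t : K => F (jet_shift v z t)) 0 (1 : K).

Lemma total_diffE N i F z : total_diff N i F z = jet_d (inl i) F z +
  \sum_(q < N) \sum_(k : q.-tuple 'I_n | sorted leq (map val k))
    jet_y z (i :: k) * jet_d (inr (k : seq _)) F z.
Proof. by []. Qed.

Lemma jet_dE v F z : jet_d v F z = 'D_1 (fun t : K => F (jet_shift v z t)) 0.
Proof. by rewrite /jet_d derive1E. Qed.

(** Derivability accompanies the value because the rules for sums and products require it of their
    arguments. *)
Definition has_td N i F F' := jet_derivable F /\ total_diff N i F = F'.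

Section Derivation.
Variables (N : nat) (i : 'I_n).

Lemma has_tdD F F' G G' : has_td N i F F' -> has_td N i G G' ->
  has_td N i (fun z => F z + G z) (fun z => F' z + G' z).
Proof.
move=> [dF <-] [dG <-]; split=> [v z|]; first exact: derivableD.
have dE v z : jet_d v (fun z => F z + G z) z = jet_d v F z + jet_d v G z.
  by rewrite !jet_dE; apply: deriveD.
apply/funext => z; rewrite !total_diffE dE addrACA; congr (_ + _).
rewrite -big_split; apply: eq_bigr => q _; rewrite -big_split.
by apply: eq_bigr => k _; rewrite dE mulrDr.
Qed.

Lemma has_td0 : has_td N i (fun=> 0) (fun=> 0).
Proof.
have dE v z : jet_d v (fun=> 0 : K) z = 0 by rewrite jet_dE derive_cst.
split=> [v z|]; first exact: derivable_cst.
apply/funext => z; rewrite total_diffE dE add0r big1 // => q _.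
by rewrite big1 // => k _; rewrite dE mulr0.
Qed.

Lemma has_tdN F F' : has_td N i F F' ->
  has_td N i (fun z => - F z) (fun z => - F' z).
Proof.
move=> [dF <-]; split=> [v z|]; first exact: derivableN.
have dE v z : jet_d v (fun z => - F z) z = - jet_d v F z.
  by rewrite !jet_dE; apply: deriveN.
apply/funext => z; rewrite !total_diffE dE opprD; congr (_ + _).
rewrite -sumrN; apply: eq_bigr => q _; rewrite -sumrN.
by apply: eq_bigr => k _; rewrite dE mulrN.
Qed.

Lemma has_tdM F F' G G' : has_td N i F F' -> has_td N i G G' ->
  has_td N i (fun z => F z * G z) (fun z => F' z * G z + F z * G' z).
Proof.
move=> [dF <-] [dG <-]; split=> [v z|]; first exact: derivableM.
have dE v z : jet_d v (fun z => F z * G z) z = jet_d v F z * G z + F z * jet_d v G z.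
  rewrite !jet_dE; have := deriveM (dF v z) (dG v z); rewrite /= jet_shift0 => ->.
  by rewrite addrC; congr (_ + _); rewrite [LHS]mulrC.
apply/funext => z; rewrite !total_diffE dE mulrDl mulrDr addrACA; congr (_ + _).
rewrite mulr_suml mulr_sumr -big_split; apply: eq_bigr => q _.
rewrite mulr_suml mulr_sumr -big_split.
by apply: eq_bigr => k _; rewrite dE /=; ring.
Qed.

Lemma has_td_sum (I : finType) (P : pred I) (F F' : I -> jet K n -> K) :
  (forall j, P j -> has_td N i (F j) (F' j)) ->
  has_td N i (fun z => \sum_(j | P j) F j z) (fun z => \sum_(j | P j) F' j z).
Proof.
(* The sum is moved to the space of functions, where [big_ind2] can relate both sides. *)
move=> FF'; have E (H : I -> jet K n -> K) r :
    (fun z => \sum_(j <- r | P j) H j z) =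
    \big[(fun H1 H2 z => H1 z + H2 z)/(fun=> 0)]_(j <- r | P j) H j.
  elim: r => [|j r IH]; first by apply/funext => z; rewrite !big_nil.
  rewrite big_cons -IH; case: ifP => Pj; apply/funext => z; by rewrite big_cons Pj.
rewrite !E; apply: (big_ind2 (has_td N i)) => //; first exact: has_td0.
by move=> F1 F1' F2 F2' H1 H2; apply: has_tdD.
Qed.

Lemma has_td_prod (I : finType) (A : {set I}) (F F' : I -> jet K n -> K) :
  (forall j, j \in A -> has_td N i (F j) (F' j)) ->
  has_td N i (fun z => \prod_(j in A) F j z)
    (fun z => \sum_(j in A) F' j z * \prod_(k in A :\ j) F k z).
Proof.
have [m] := ubnP #|A|; elim: m A => // m IH A Am H.
have [->|/set0Pn[x xA]] := eqVneq A set0.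
  under [X in has_td _ _ X]eq_fun do rewrite big_set0.
  under [X in has_td _ _ _ X]eq_fun do rewrite big_set0.
  split=> [v z|]; first exact: derivable_cst.
  have dE v z : jet_d v (fun=> 1 : K) z = 0 by rewrite jet_dE derive_cst.
  apply/funext => z; rewrite total_diffE dE add0r big1 // => q _.
  by rewrite big1 // => k _; rewrite dE mulr0.
have xN : x \notin A :\ x by rewrite in_setD1 eqxx.
have {}IH := IH (A :\ x) _ _.
have [] := has_tdM (H x xA) (IH _ _).
- by move: Am; rewrite (cardsD1 x) xA.
- by move=> j; rewrite in_setD1 => /andP[_]; apply: H.
have -> : (fun z => \prod_(j in A) F j z) =
    (fun z => F x z * \prod_(j in A :\ x) F j z).
  by apply/funext => z; rewrite (big_setD1 x).
move=> dP tP; split=> //; rewrite tP; apply/funext => z.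
rewrite [RHS](big_setD1 x) //=.
congr (_ + _); rewrite mulr_sumr; apply: eq_bigr => j; rewrite in_setD1.
move=> /andP[jx jA]; have xAj : x \in A :\ j by rewrite in_setD1 xA eq_sym jx.
rewrite [X in _ = _ * X](big_setD1 x xAj) mulrCA; congr (_ * (_ * _)).
by apply: eq_bigl => k; rewrite !in_setD1 andbCA.
Qed.

End Derivation.

(** Among the nondecreasing tuples only the sorted version of [s] has the multi-index of [s]. This
    collapses the sum in [total_diff] whenever the derivatives are Kronecker symbols. *)
Lemma sum_sorted_tuples N s (g : seq 'I_n -> K) : (size s < N)%N ->
  (forall s', perm_eq s s' -> g s = g s') ->
  \sum_(q < N) \sum_(k : q.-tuple 'I_n | sorted leq (map val k))
    g k * (multi_index s == multi_index k)%:R = g s.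
Proof.
move=> sN gP; pose s0 := sort (relpre val leq) s.
have s0P : perm_eq s s0 by rewrite perm_sym perm_sort.
rewrite (bigD1 (Ordinal sN)) //= [X in _ + X]big1 ?addr0; last first.
  move=> q qs; apply: big1 => k _; rewrite multi_index_eq.
  case: (boolP (perm_eq _ _)) => [/perm_size sk|]; last by rewrite mulr0.
  by case/eqP: qs; apply: val_inj; rewrite /= sk size_tuple.
have s0s : size s0 == size s by rewrite size_sort.
rewrite (bigD1 (Tuple s0s)) /=; last first.
  by rewrite sorted_map; apply: sort_sorted => a b; apply: leq_total.
rewrite multi_index_eq s0P mulr1 [X in _ + X]big1 ?addr0; first by rewrite -gP.
move=> k /andP[ks ne]; rewrite multi_index_eq.
case: (boolP (perm_eq _ _)) => [sk|]; last by rewrite mulr0.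
case/eqP: ne; apply: val_inj => /=; apply: (inj_map val_inj).
apply: (sorted_eq leq_trans anti_leq) => //.
  by rewrite sorted_map; apply: sort_sorted => a b; apply: leq_total.
by apply: perm_map; rewrite perm_sym (perm_trans _ sk) // perm_sort.
Qed.

Lemma derive_line f (g : K -> K) (a v : base K n) :
  (forall t, g t = f (t *: v + a)) ->
  (derivable g 0 (1 : K) <-> derivable f a v) /\ derive1 g 0 = 'D_v f a.
Proof.
move=> gE.
have E : (fun h : K => h^-1 *: ((g \o shift 0) (h *: (1 : K)) - g 0)) =
         (fun h => h^-1 *: ((f \o shift a) (h *: v) - f a)).
  apply/funext => h /=; rewrite !gE scale0r add0r addr0.
  by rewrite (_ : h *: (1 : K) = h); last exact: mulr1.
by rewrite derive1E /derivable /derive E.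
Qed.

Lemma jet_d_lift f v z : smooth f ->
  derivable (fun t : K => lift_base f (jet_shift v z t)) 0 (1 : K) /\
  jet_d v (lift_base f) z =
    match v with inl i => pd (Some i) f (jet_base z)
    | inr s => pd None f (jet_base z) * (multi_index [::] == multi_index s)%:R end.
Proof.
move=> fs; have fd c b := proj2 (fs [::]) c b.
case: v => [i|s].
  have gE t : lift_base f (jet_shift (inl i) z t) =
      f (t *: (base_dir K (Some i) : base K n) + jet_base z).
    rewrite /lift_base /jet_base /jet_y /=; congr (f (_, _)).
      by rewrite addrC.
    by rewrite /= [_ *: _]mulr0 add0r.
  by have [H1 H2] := derive_line gE; split; [apply/H1/fd|].
have [s0|s0] := boolP (multi_index [::] == multi_index s).
  have gE t : lift_base f (jet_shift (inr s) z t) =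
      f (t *: (base_dir K None : base K n) + jet_base z).
    rewrite /lift_base /jet_base /jet_y /= s0; congr (f (_, _)).
      by rewrite /= scaler0 add0r.
    by rewrite addrC.
  by rewrite mulr1; have [H1 H2] := derive_line gE; split; [apply/H1/fd|].
have E : (fun t : K => lift_base f (jet_shift (inr s) z t)) = fun=> f (jet_base z).
  apply/funext => t; rewrite /lift_base /jet_base /jet_y /= (negbTE s0).
  by rewrite mulr0 addr0.
rewrite mulr0 jet_dE E; split; last exact: derive_cst.
exact: derivable_cst.
Qed.

(** The bound on N admits q = 0, the derivative in y itself; a function of the base has no other
    derivative in the y-coordinates. *)
Lemma has_td_lift N i f : (0 < N)%N -> smooth f ->
  has_td N i (lift_base f) (fun z => lift_base (pd (Some i) f) z +
     jet_y z [:: i] * lift_base (pd None f) z).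
Proof.
move=> N0 fs; split=> [v z|]; first by case: (jet_d_lift v z fs).
apply/funext => z; rewrite total_diffE (jet_d_lift _ z fs).2; congr (_ + _).
rewrite -(@sum_sorted_tuples N [::]
  (fun s => jet_y z (i :: s) * pd None f (jet_base z))) //.
  apply: eq_bigr => q _; apply: eq_bigr => k _.
  by rewrite (jet_d_lift _ z fs).2 mulrA.
by move=> s' ss'; congr (_ * _); apply: jet_y_perm; rewrite perm_cons.
Qed.

Lemma has_td_jet_y N i s : (size s < N)%N ->
  has_td N i (fun z => jet_y z s) (fun z => jet_y z (i :: s)).
Proof.
move=> sN.
have H v z : derivable (fun t : K => jet_y (jet_shift v z t) s) 0 (1 : K) /\
    jet_d v (fun z => jet_y z s) z =
    match v with inl _ => 0
    | inr s' => (multi_index s == multi_index s')%:R end.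
  case: v => [j|s']; rewrite jet_dE.
    by split; [exact: derivable_cst|exact: derive_cst].
  rewrite /jet_y /=; set c := _%:R; set u := jet_u z _.
  have D : is_derive (0 : K) (1 : K) (fun t : K => u + t * c) c.
    apply: is_derive_eq; rewrite ?add0r.
    by rewrite /= ?scaler0 ?add0r; exact: mulr1.
  by case: D.
split=> [v z|]; first by case: (H v z).
apply/funext => z; rewrite total_diffE (H _ z).2 add0r.
rewrite -(@sum_sorted_tuples N s (fun s => jet_y z (i :: s))) //.
  by apply: eq_bigr => q _; apply: eq_bigr => k _; rewrite (H _ z).2.
by move=> s' ss'; apply: jet_y_perm; rewrite perm_cons.
Qed.

End JetCalculus.

(** * Functions of bounded jet order *)

Section JetOrder.
Variables (K : numFieldType) (n : nat).
Implicit Types (F G : jet K n -> K) (z : jet K n) (s : seq 'I_n).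

Definition agree_upto r z z' := jet_x z = jet_x z' /\
  forall s, (size s <= r)%N -> jet_y z s = jet_y z' s.

Definition order_le r F := forall z z', agree_upto r z z' -> F z = F z'.

Lemma agree_upto_shift r z z' v t :
  agree_upto r z z' -> agree_upto r (jet_shift v z t) (jet_shift v z' t).
Proof.
move=> [xx yy]; case: v => [i|s]; split=> //=; first by rewrite xx.
by move=> s' /yy; rewrite /jet_y /= => ->.
Qed.

Lemma agree_upto_le r r' z z' : (r <= r')%N -> agree_upto r' z z' -> agree_upto r z z'.
Proof. by move=> rr [xx yy]; split=> // s sr; apply/yy/(leq_trans sr). Qed.

Lemma order_le_jet_d r v F : order_le r F -> order_le r (jet_d v F).
Proof.
move=> Fr z z' zz; rewrite /jet_d; congr (derive1 _ 0); apply/funext => t.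
exact/Fr/agree_upto_shift.
Qed.

Lemma jet_dy_eq0 r F s z : order_le r F -> (r < size s)%N -> jet_d (inr s) F z = 0.
Proof.
move=> Fr rs; rewrite /jet_d.
have -> : (fun t => F (jet_shift (inr s) z t)) = fun=> F z.
  apply/funext => t; apply: Fr; split=> //= s' s'r; rewrite /jet_y /=.
  rewrite multi_index_eq; case: (boolP (perm_eq _ _)) => [/perm_size E|_].
    by rewrite E leqNgt rs in s'r.
  by rewrite mulr0 addr0.
exact: derive1_cst.
Qed.

(** Derivatives of [F] in coordinates of order above r vanish, so every truncation beyond r acts on
    [F] in the same way; this removes the dependence of the operators on lambda. *)
Lemma total_diff_order r lambda N i F : order_le r F -> (r < lambda)%N ->
  (lambda <= N)%N -> total_diff lambda i F = total_diff N i F.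
Proof.
move=> Fr rl lN; apply/funext => z; rewrite !total_diffE; congr (_ + _).
rewrite (big_ord_widen N (fun q => \sum_(k : q.-tuple 'I_n | sorted leq (map val k))
    jet_y z (i :: k) * jet_d (inr (k : seq _)) F z)) //.
rewrite [RHS](bigID (fun q : 'I_N => (q < lambda)%N)) /= [X in _ + X]big1 ?addr0 //.
move=> q; rewrite -leqNgt => lq; apply: big1 => k _.
by rewrite (jet_dy_eq0 _ Fr) ?mulr0 // size_tuple (leq_trans rl).
Qed.

Lemma order_le_total_diff r lambda i F : order_le r F -> (lambda <= r.+1)%N ->
  order_le r.+1 (total_diff lambda i F).
Proof.
move=> Fr lr z z' zz; have zz' := agree_upto_le (leqnSn r) zz.
rewrite !total_diffE (order_le_jet_d _ Fr zz'); congr (_ + _).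
apply: eq_bigr => q _; apply: eq_bigr => k _.
rewrite (order_le_jet_d _ Fr zz') (proj2 zz) //= size_tuple.
exact: leq_trans lr.
Qed.

Lemma order_le_lift f : order_le 0 (@lift_base K n f).
Proof. by move=> z z' [xx yy]; rewrite /lift_base /jet_base xx yy. Qed.

Lemma order_le_prolong_rev (X : 'I_n -> base K n -> K) (Y : base K n -> K) s :
  order_le (size s) (prolong_rev X Y s).
Proof.
elim: s => [|i s IH]; first exact: order_le_lift.
move=> z z' zz; rewrite /=; congr (_ - _).
  exact: (order_le_total_diff i IH (leqnn _)).
apply: eq_bigr => k _; congr (_ * _).
  apply: (order_le_total_diff i (order_le_lift _) (leqnn _)).
  exact: agree_upto_le zz.
by apply: (proj2 zz); rewrite size_rcons size_rev.
Qed.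

End JetOrder.

(** * Faa di Bruno formula and prolongations *)

Section FaaDiBruno.
Variables (K : numFieldType) (n : nat) (T : finType) (idx : T -> 'I_n).
Hypothesis pdC : @symmetric_pd K n.
Variable f : base K n -> K.
Hypothesis f_smooth : smooth f.
Variable Z : {set T}.
Implicit Types (A B : {set T}) (P : {set {set T}}) (z : jet K n).

Definition block_mon P z : K :=
  \prod_(B in P) jet_y z (map idx (enum B)).

(* The blocks of [P] index the factors y of the monomial and the elements of
   [A] outside of them the x-derivatives; when [Z] is not empty, one factor y
   was present from the start and accounts for no y-derivative. *)
Definition faa_term A P z : K :=
  pd_xy (map idx (enum (A :\: cover P))) (#|P| - (Z != set0)) f
    (jet_base z) * block_mon P z.

Definition faa_sum A z : K :=
  \sum_(P | ppart A P && (Z \subset cover P)) faa_term A P z.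

Lemma enum_setU1 x A : x \notin A -> perm_eq (enum (x |: A)) (x :: enum A).
Proof.
move=> xA; apply: uniq_perm; rewrite /= ?enum_uniq ?mem_enum ?xA //.
by move=> y; rewrite inE !mem_enum in_setU1.
Qed.

Lemma jet_y_setU1 x B z : x \notin B ->
  jet_y z (map idx (enum (x |: B))) = jet_y z (idx x :: map idx (enum B)).
Proof. by move=> xB; apply/jet_y_perm/(perm_map idx (enum_setU1 xB)). Qed.

Lemma cover_setU1 B P : cover (B |: P) = B :|: cover P.
Proof.
apply/setP => y; rewrite inE; apply/bigcupP/orP.
  case=> C; rewrite !inE => /orP[/eqP-> yB|CP yC]; first by left.
  by right; apply/bigcupP; exists C.
case=> [yB|/bigcupP[C CP yC]]; first by exists B; rewrite ?inE ?eqxx.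
by exists C => //; rewrite inE CP orbT.
Qed.

(** By the Leibniz rule, the x-derivative of the coefficient leaves x uncovered, its y-derivative
    comes with a factor y_i, that is, the block [[set x]], and differentiating a factor of the
    monomial puts x into its block. *)
Lemma has_td_faa_term N x A P : x \notin A -> ppart A P ->
  (Z \subset cover P) -> (#|A| < N)%N ->
  has_td N (idx x) (faa_term A P) (fun z => faa_term (x |: A) P z
    + faa_term (x |: A) ([set x] |: P) z
    + \sum_(B in P) faa_term (x |: A) ((x |: B) |: (P :\ B)) z).
Proof.
move=> xA pP ZP AN; have /ppartP[tP P0 PA] := pP.
have xN B : B \in P -> x \notin B.
  by move=> BP; apply: contra xA; apply: PA.
have BN B : B \in P -> (#|B| < N)%N.
  move=> BP; apply: leq_ltn_trans AN; apply/subset_leq_card.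
  by apply/subsetP => y; apply: PA.
set g := pd_xy (map idx (enum (A :\: cover P))) (#|P| - (Z != set0)) f.
have gs : smooth g by apply: smooth_pds.
have := has_tdM (has_td_lift (idx x) (leq_ltn_trans (leq0n _) AN) gs)
  (@has_td_prod K n N (idx x) _ P (fun B z => jet_y z (map idx (enum B)))
     (fun B z => jet_y z (idx x :: map idx (enum B))) _).
move=> /(_ _)[|dF tF].
  by move=> B BP; apply: has_td_jet_y; rewrite size_map -cardE BN.
split=> //; rewrite tF; apply/funext => z.
(* The subtraction in the y-order is truncated: it commutes with adding a block because a block is
   already there to discount. *)
have cP0 : (Z != set0 <= #|P|)%N.
  case: (eqVneq Z set0) => // /set0Pn[y yZ].
  have /bigcupP[B BP _] := subsetP ZP y yZ.
  by rewrite card_gt0; apply/set0Pn; exists B.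
have xP : x \notin cover P by apply/bigcupP => -[B /xN/negbTE ->].
have x1P : [set x] \notin P.
  by apply/negP => /xN; rewrite inE eqxx.
have EA : (x |: A) :\: (x |: cover P) = A :\: cover P.
  apply/setP => y; rewrite !inE; have [->|//] := eqVneq y x.
  by rewrite (negbTE xA) andbF.
rewrite mulrDl; congr (_ + _ + _).
- congr (_ * _); rewrite /lift_base -[LHS]/(pd_xy (idx x :: _) _ f _).
  congr (_ _); apply: pd_xy_perm => //; rewrite perm_sym -map_cons.
  apply: perm_map; apply: (@perm_trans _ (enum (x |: A :\: cover P))).
    rewrite (_ : (x |: A) :\: _ = x |: A :\: cover P) //.
    apply/setP => y; rewrite !inE; have [->|//] := eqVneq y x.
    by rewrite xP.
  by apply: enum_setU1; rewrite inE (negbTE xA) andbF.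
- rewrite /faa_term /block_mon big_setU1 //= cover_setU1 EA.
  rewrite cardsU1 x1P add1n subSn // enum_set1 /lift_base (pd_y_xy pdC) //.
  by rewrite mulrCA mulrA.
- rewrite mulr_sumr; apply: eq_bigr => B BP.
  have EC : cover ((x |: B) |: (P :\ B)) = x |: cover P.
    rewrite -{2}(setD1K BP) !cover_setU1.
    by rewrite setUA.
  have nxB : x |: B \notin P :\ B.
    apply/negP; rewrite in_setD1 => /andP[_ /xN]; rewrite !inE eqxx //.
  rewrite /faa_term EC EA cardsU1 nxB.
  rewrite (_ : (true + #|P :\ B| = #|P|)%N); last by rewrite (cardsD1 B P) BP.
  congr (_ * _); rewrite /block_mon (big_setU1 _ nxB) /=.
  by rewrite jet_y_setU1 // xN.
Qed.

(** As x lies outside [Z], the insertion of x does not affect whether [Z] is covered, so the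
    recursion of [sum_ppartU1] survives this restriction. *)
Lemma has_td_faa_sum N x A : x \notin A -> Z \subset A -> (#|A| < N)%N ->
  has_td N (idx x) (faa_sum A) (faa_sum (x |: A)).
Proof.
move=> xA ZA AN; have xZ : x \notin Z by apply: contra xA; apply: (subsetP ZA).
have -> : faa_sum (x |: A) = fun z =>
    \sum_(P | ppart A P && (Z \subset cover P))
     (faa_term (x |: A) P z + faa_term (x |: A) ([set x] |: P) z
      + \sum_(B in P) faa_term (x |: A) ((x |: B) |: (P :\ B)) z).
  apply/funext => z; rewrite /faa_sum big_mkcondr (sum_ppartU1 _ xA) [RHS]big_mkcondr.
  have subx C : (Z \subset x |: C) = (Z \subset C).
    apply/subsetP/subsetP => ZC y yZ; have := ZC y yZ.
      by rewrite !inE => /orP[/eqP yx|//]; rewrite -yx yZ in xZ.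
    by rewrite !inE => ->; rewrite orbT.
  apply: eq_bigr => P pP; rewrite cover_setU1 subx.
  have E B : B \in P ->
      (Z \subset cover ((x |: B) |: (P :\ B))) = (Z \subset cover P).
    move=> BP; rewrite -{2}(setD1K BP) !cover_setU1.
    by rewrite -setUA subx.
  case: ifP => ZP; last first.
    rewrite !add0r; apply: big1 => B BP; by rewrite E // ZP.
  by congr (_ + _); apply: eq_bigr => B BP; rewrite E // ZP.
by apply: has_td_sum => P /andP[pP ZP]; apply: has_td_faa_term.
Qed.

Lemma sum_ppart0 (V : nmodType) (G : {set {set T}} -> V) :
  \sum_(P | ppart set0 P) G P = G set0.
Proof.
apply: big_pred1 => P; apply/ppartP/eqP => [[tP P0 PA]|->].
  apply/setP => B; rewrite inE; apply/negP => BP.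
  have [y yB] := P0 _ BP; by have := PA _ _ BP yB; rewrite inE.
by split=> [B C y|B|B y]; rewrite inE.
Qed.

End FaaDiBruno.

(** * Prolongation coefficients as sums over set families *)

Section ProlongFaa.
Variables (K : numFieldType) (n kappa : nat) (i : 'I_kappa -> 'I_n).
Hypothesis pdC : @symmetric_pd K n.
Variables (X : 'I_n -> base K n -> K) (Y : base K n -> K).
Hypotheses (X_smooth : forall k, smooth (X k)) (Y_smooth : smooth Y).
Implicit Types (z : jet K n) (C : {set 'I_kappa}).

(* The position [None] stands for the summation index k of y_{k,I}. *)
Definition oidx (k : 'I_n) (o : option 'I_kappa) : 'I_n :=
  if o is Some a then i a else k.

Definition oset C : {set option 'I_kappa} := None |: [set Some a | a in C].

Lemma osetU1 x C : oset (x |: C) = Some x |: oset C.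
Proof. by rewrite /oset imsetU1 setUCA. Qed.

Lemma Some_oset x C : (Some x \in oset C) = (x \in C).
Proof. by rewrite /oset !inE /= mem_imset //; move=> ? ? []. Qed.

(** Apply D to the previous identity. In the last sum Leibniz gives D(X^k) y_{k,I}, which the
    definition of the prolongation subtracts, and X^k times the raised coordinate, which continues
    the sum. *)
Lemma prolong_rev_faa (s : seq 'I_kappa) : uniq s ->
  prolong_rev X Y (map i s) = fun z =>
    faa_sum i Y set0 [set a in s] z
    - \sum_(k < n) faa_sum (oidx k) (X k) [set None] (oset [set a in s]) z
    + \sum_(k < n) lift_base (X k) z * jet_y z (k :: map i s).
Proof.
elim: s => [_|x s IH /= /andP[xs us]]; apply/funext => z.
  (* For the empty list the only family covering [None] is its singleton block; the term X^k y_k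
     cancels against the last sum. *)
  rewrite -addrA [X in _ + X]addrC -sumrB big1 ?addr0.
    rewrite /faa_sum set_nil big_mkcondr sum_ppart0 sub0set.
    rewrite /faa_term /block_mon !big_set0 cards0 sub0n.
    by rewrite set0D enum_set0 mulr1.
  move=> k _; rewrite /faa_sum /oset set_nil imset0.
  rewrite big_mkcondr sum_ppartU1 ?inE // sum_ppart0 big_set0 addr0.
  have N0 : [set None] != set0 :> {set option 'I_kappa}.
    by apply/set0Pn; exists None; rewrite inE.
  rewrite !cover_setU1 subsetUl /cover big_set0.
  rewrite subset0 (negbTE N0) add0r /faa_term /block_mon N0.
  rewrite !setU0 big_set1 enum_set1 cards1 subnn /=.
  rewrite cover1 setDv enum_set0.
  by rewrite subrr.
(* All position sets, the extra position included, have at most kappa + 1 elements, so this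
   truncation serves every step. *)
have F0 : has_td kappa.+2 (i x) (prolong_rev X Y (map i s)) (fun z =>
    faa_sum i Y set0 [set a in x :: s] z
    - \sum_(k < n) faa_sum (oidx k) (X k) [set None] (oset [set a in x :: s]) z
    + \sum_(k < n) ((lift_base (pd (Some (i x)) (X k)) z +
         jet_y z [:: i x] * lift_base (pd None (X k)) z) * jet_y z (k :: map i s)
       + lift_base (X k) z * jet_y z (i x :: k :: map i s))).
  rewrite IH // set_cons; apply: has_tdD; first apply: has_tdD.
  - apply: has_td_faa_sum; rewrite ?inE ?sub0set //.
    by rewrite ltnS (leq_trans (max_card _)) // card_ord.
  - apply: has_tdN; apply: has_td_sum => k _; rewrite osetU1.
    apply: (@has_td_faa_sum _ _ _ (oidx k) pdC _ (X_smooth k) _ _ (Some x)).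
    - by rewrite Some_oset inE.
    - exact: subsetUl.
    by rewrite ltnS (leq_trans (max_card _)) // card_option card_ord.
  - apply: has_td_sum => k _; apply: has_tdM; first exact: has_td_lift.
    apply: has_td_jet_y; rewrite /= size_map !ltnS.
    by rewrite -(card_uniqP us) (leq_trans (max_card _)) // card_ord.
have sk : (size s <= kappa)%N.
  by rewrite -(card_uniqP us) (leq_trans (max_card _)) // card_ord.
rewrite /= (@total_diff_order _ _ (size s) _ kappa.+2); first last.
- by rewrite size_map ltnS (leq_trans sk).
- by rewrite size_map.
- by have := @order_le_prolong_rev K n X Y (map i s); rewrite size_map.
rewrite F0.2 -[LHS]addrA; congr (_ + _); rewrite -sumrB.
apply: eq_bigr => k _.
(* The operator of order one yields the same expression for D(X^k), so the two copies cancel. *)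
rewrite (@has_td_lift _ _ 1 (i x) (X k) _ _).2 // (@jet_y_perm K n z (rcons _ k)
  (k :: map i s)); last by rewrite perm_rcons perm_cons perm_rev.
rewrite addrAC subrr add0r; congr (_ * _); apply: jet_y_perm.
by rewrite -[_ :: _]/([:: i x] ++ [:: k] ++ _) perm_catCA.
Qed.

Lemma prolong_faa z :
  prolong X Y [seq i a | a <- enum 'I_kappa] z =
    faa_sum i Y set0 [set: 'I_kappa] z
    - \sum_(k < n) faa_sum (oidx k) (X k) [set None] [set: option 'I_kappa] z
    + \sum_(k < n) lift_base (X k) z * jet_y z (k :: [seq i a | a <- enum 'I_kappa]).
Proof.
rewrite /prolong -map_rev prolong_rev_faa ?rev_uniq ?enum_uniq //.
have -> : [set a in rev (enum 'I_kappa)] = [set: 'I_kappa].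
  by apply/setP => a; rewrite !inE mem_rev mem_enum.
have -> : oset [set: 'I_kappa] = [set: option 'I_kappa].
  by apply/setP => -[a|]; rewrite ?Some_oset !inE.
congr (_ + _); apply: eq_bigr => k _; congr (_ * _); apply: jet_y_perm.
by rewrite perm_cons perm_map // perm_rev.
Qed.

End ProlongFaa.

Lemma kroneckerE (T : eqType) (s t : seq T) :
  size s = size t -> kronecker s t = (s == t).
Proof.
elim: s t => [|x s IH] [|y t] //=; rewrite /kronecker ?big_nil //= => -[st].
by rewrite big_cons /= [X in (_ * X)%N](IH t st) eqseq_cons mulnb.
Qed.

(** The equality of lists says that k after s is w, so the one surviving k is w after [s^-1]. *)
Lemma sum_reindexed (V : pzRingType) M n (s : 'S_M) (w : 'I_M -> 'I_n)
    (H : {ffun 'I_M -> 'I_n} -> V) :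
  \sum_(k : {ffun 'I_M -> 'I_n})
    ([seq w j | j <- enum 'I_M] == [seq k (s j) | j <- enum 'I_M])%:R * H k =
  H [ffun j => w ((s^-1)%g j)].
Proof.
rewrite (bigD1 [ffun j => w ((s^-1)%g j)]) //= big1 => [|k ne].
  rewrite (_ : _ == _) ?mul1r ?addr0 //; apply/eqP/eq_map => j.
  by rewrite ffunE permK.
case: eqP => [E|]; last by rewrite mul0r.
case/eqP: ne; apply/ffunP => j; rewrite ffunE.
move/eq_in_map: E => /(_ ((s^-1)%g j)); rewrite permKV => -> //.
by rewrite mem_enum.
Qed.

(** * Terms of a given type *)

Section FixedType.
Variables (K : numFieldType) (n kappa : nat) (i : 'I_kappa -> 'I_n).
Hypothesis kappa_gt0 : (0 < kappa)%N.
Variables (d a b : nat) (lam : {ffun 'I_d -> 'I_a}) (mu : {ffun 'I_d -> 'I_b}).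
Hypotheses (lam_gt0 : forall e, (0 < lam e)%N) (lam_inj : injective lam).
Variable z : jet K n.
Let M := weight lam mu.
Let p := (\sum_(e < d) mu e)%N.
Hypothesis M_gt0 : (0 < M)%N.
Variables (F : {set 'S_M}) (F_reps : coset_reps F).

Definition slot_mon (k : 'I_M -> 'I_n) : K := \prod_(e < d) \prod_(nu < mu e)
  jet_y z [seq k (slot nu g) | g <- enum 'I_(lam e)].

(** By the symmetry of the jet coordinates each factor depends on its block only as a set. *)
Lemma slot_monE (T : finType) (f : 'I_M -> T) (g : T -> 'I_n) (k : 'I_M -> 'I_n) :
  injective f -> k =1 g \o f ->
  slot_mon k = block_mon g (imblocks f (slot_blocks lam mu)) z.
Proof.
move=> fI kE; rewrite /block_mon /imblocks big_imset /=; last first.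
  by move=> B C _ _; apply: imset_inj.
rewrite big_slot_blocks //; apply: eq_bigr => e _; apply: eq_bigr => nu _.
have -> : [seq k (slot nu x) | x <- enum 'I_(lam e)] =
    map g [seq f (slot nu x) | x <- enum 'I_(lam e)].
  by rewrite -map_comp; apply: eq_map => x; apply: kE.
apply: jet_y_perm.
apply: perm_map; apply: uniq_perm; rewrite ?enum_uniq //.
  rewrite map_inj_uniq ?enum_uniq //; apply: inj_comp => //; exact: slot_inj.
move=> x; rewrite mem_enum /block -imset_comp.
by apply/mapP/imsetP => -[g' _ ->]; exists g'; rewrite ?mem_enum.
Qed.

Lemma sum_slot_mon (T : finType) (f : 'I_M -> T) (g : T -> 'I_n) (c : K) :
  injective f ->
  \sum_(s in F) c * slot_mon [ffun j => g (f ((s^-1)%g j))] =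
  \sum_(P | partition P (f @: setT) &&
            perm_eq (block_sizes P) (type_sizes lam mu)) c * block_mon g P z.
Proof.
move=> fI; pose H P := c * block_mon g P z.
transitivity (\sum_(s in F) H (imblocks (f \o (s^-1)%g) (slot_blocks lam mu))).
  apply: eq_bigr => s _; congr (_ * _); apply: slot_monE => [|j].
    by apply: inj_comp => //; apply: perm_inj.
  by rewrite ffunE.
rewrite (sum_imblocks H M_gt0 (slot_blocks_partition mu lam_gt0) fI); first last.
- exact: coset_reps_surj.
- exact: coset_reps_inj.
apply: eq_bigl => P; congr (_ && _); apply/idP/idP => sP.
  exact: perm_trans sP (block_sizes_slot_blocks mu lam_gt0).
by rewrite (perm_trans sP) // perm_sym block_sizes_slot_blocks.
Qed.

Let ksigma (k : {ffun 'I_M -> 'I_n}) (s : 'S_M) := [seq k (s j) | j <- enum 'I_M].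
Let itau (t : 'S_kappa) := [seq i (t j) | j <- enum 'I_kappa].

Let size_ksigma k s : size (ksigma k s) = M.
Proof. by rewrite size_map size_enum_ord. Qed.

Let itauE t : itau t = map i (perm_seq t).
Proof. by rewrite /perm_seq -map_comp. Qed.

Lemma type_card (T : finType) (P : {set {set T}}) :
  perm_eq (block_sizes P) (type_sizes lam mu) -> #|P| = p.
Proof.
by move/perm_size; rewrite size_type_sizes /block_sizes size_map -cardE.
Qed.

Lemma type_card_cover (T : finType) (P : {set {set T}}) : trivIset P ->
  perm_eq (block_sizes P) (type_sizes lam mu) -> #|cover P| = M.
Proof.
move=> /eqP <- /perm_sumn; rewrite sumn_type_sizes => sE; rewrite /M -sE.
by rewrite sumnE big_map big_enum.
Qed.

Lemma partition_coverE (T : finType) (P : {set {set T}}) C :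
  partition P C = ppart setT P && (cover P == C).
Proof. by rewrite /partition /ppart subsetT andbT andbC. Qed.

(** Shuffles become subsets C of M positions, the Kronecker symbols determine k, and the
    representatives become the partitions of C. Since C is the cover of its partition, the double
    sum is one over families. *)
Lemma sum_fixed_type_Y (Y : base K n -> K) :
  \sum_(k : {ffun 'I_M -> 'I_n})
    (\sum_(s in F) \sum_(t in shuffles kappa M)
      (kronecker (take M (itau t)) (take M (ksigma k s)))%:R *
      pd_xy (drop M (itau t)) p Y (jet_base z)) * slot_mon k =
  \sum_(P | ppart setT P && perm_eq (block_sizes P) (type_sizes lam mu))
    faa_term i Y set0 setT P z.
Proof.
have x0 := Ordinal kappa_gt0.
pose c (C : {set 'I_kappa}) := pd_xy (map i (enum (~: C))) p Y (jet_base z).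
transitivity (\sum_(C : {set 'I_kappa} | #|C| == M) \sum_(s in F)
    \sum_(k : {ffun 'I_M -> 'I_n})
    (map i (enum C) == ksigma k s)%:R * (c C * slot_mon k)).
  rewrite [RHS](eq_bigr (fun C : {set 'I_kappa} =>
     \sum_(k : {ffun 'I_M -> 'I_n}) \sum_(s in F)
     (map i (enum C) == ksigma k s)%:R * (c C * slot_mon k))); last first.
    by move=> C _; rewrite exchange_big.
  rewrite [RHS]exchange_big; apply: eq_bigr => k _.
  rewrite [RHS]exchange_big mulr_suml; apply: eq_bigr => s _.
  pose H u v := (kronecker (map i u) (take M (ksigma k s)))%:R *
     pd_xy (map i v) p Y (jet_base z).
  rewrite (eq_bigr (fun t => H (take M (perm_seq t)) (drop M (perm_seq t)))); last first.
    by move=> t _; rewrite /H itauE map_take map_drop.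
  rewrite sum_shuffles mulr_suml; apply: eq_bigr => C /eqP CM.
  rewrite /H mulrA; congr (_ * _ * _); rewrite take_oversize ?size_ksigma //.
  by rewrite kroneckerE // size_map -cardE size_ksigma.
transitivity (\sum_(C : {set 'I_kappa} | #|C| == M)
    \sum_(P | partition P C && perm_eq (block_sizes P) (type_sizes lam mu))
       c C * block_mon i P z).
  apply: eq_bigr => C /eqP CM.
  pose f (j : 'I_M) := nth x0 (enum C) j.
  have szC : size (enum C) = M by rewrite -cardE.
  have fI : injective f.
    move=> j j' /eqP; rewrite nth_uniq ?enum_uniq ?szC // => /eqP; exact: val_inj.
  have fE : map f (enum 'I_M) = enum C.
    rewrite -[RHS](mkseq_nth x0) szC /mkseq -val_enum_ord -map_comp.
    exact: eq_map.
  have fC : f @: setT = C.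
    apply/setP => x; rewrite -[RHS]mem_enum -fE.
    by apply/imsetP/mapP => -[j _ ->]; exists j; rewrite ?inE ?mem_enum.
  rewrite [RHS](eq_bigl (fun P => partition P (f @: setT) &&
    perm_eq (block_sizes P) (type_sizes lam mu))); last by move=> P; rewrite fC.
  rewrite -(sum_slot_mon i _ fI); apply: eq_bigr => s _.
  rewrite -(sum_reindexed s (i \o f) (fun k => _ * slot_mon k)).
  by apply: eq_bigr => k _; rewrite -fE -map_comp.
rewrite (exchange_big_dep (fun P =>
  ppart setT P && perm_eq (block_sizes P) (type_sizes lam mu))) /=; last first.
  by move=> C P _; rewrite partition_coverE => /andP[/andP[-> _] ->].
apply: eq_bigr => P /andP[pP sP]; rewrite (big_pred1 (cover P)).
  rewrite /faa_term eqxx subn0 (type_card sP) setTD; exact: erefl.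
move=> C; rewrite partition_coverE pP sP andbT /= eq_sym.
have [->|_] := eqVneq C (cover P); last by rewrite andbF.
by rewrite (type_card_cover _ sP) ?eqxx //; case/and3P: pP.
Qed.

Hypothesis pdC : @symmetric_pd K n.

(** Here the component of X depends on k_{sigma(M)}. A sum over its value k0 completes the M - 1
    Kronecker conditions to M, and the argument for Y applies with [None] as an additional position.
    The block of [None] stems from the initial factor y_k, whence p - 1 derivatives in y. *)
Lemma sum_fixed_type_X (X : 'I_n -> base K n -> K) (X_smooth : forall k, smooth (X k)) k_dflt :
  \sum_(k : {ffun 'I_M -> 'I_n})
    (\sum_(s in F) \sum_(t in shuffles kappa M.-1)
      (kronecker (take M.-1 (itau t)) (take M.-1 (ksigma k s)))%:R *
      pd_xy (drop M.-1 (itau t)) p.-1 (X (last k_dflt (ksigma k s))) (jet_base z))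
    * slot_mon k =
  \sum_(k0 < n) \sum_(P | (ppart setT P && (None \in cover P)) &&
                          perm_eq (block_sizes P) (type_sizes lam mu))
    faa_term (oidx i k0) (X k0) [set None] setT P z.
Proof.
pose c k0 (C : {set 'I_kappa}) :=
  pd_xy (map i (enum (~: C))) p.-1 (X k0) (jet_base z).
transitivity (\sum_(k0 < n) \sum_(C : {set 'I_kappa} | #|C| == M.-1)
    \sum_(s in F) \sum_(k : {ffun 'I_M -> 'I_n})
    (rcons (map i (enum C)) k0 == ksigma k s)%:R * (c k0 C * slot_mon k)).
  rewrite [RHS](eq_bigr (fun k0 : 'I_n =>
     \sum_(k : {ffun 'I_M -> 'I_n}) \sum_(s in F)
     \sum_(C : {set 'I_kappa} | #|C| == M.-1)
     (rcons (map i (enum C)) k0 == ksigma k s)%:R * (c k0 C * slot_mon k))); last first.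
    move=> k0 _; transitivity (\sum_(C : {set 'I_kappa} | #|C| == M.-1)
      \sum_(k : {ffun 'I_M -> 'I_n}) \sum_(s in F)
        (rcons (map i (enum C)) k0 == ksigma k s)%:R * (c k0 C * slot_mon k)).
      by apply: eq_bigr => C _; rewrite exchange_big.
    by rewrite exchange_big; apply: eq_bigr => k _; rewrite exchange_big.
  rewrite [RHS]exchange_big; apply: eq_bigr => k _.
  rewrite [RHS]exchange_big mulr_suml; apply: eq_bigr => s _.
  pose H u v := (kronecker (map i u) (take M.-1 (ksigma k s)))%:R *
     pd_xy (map i v) p.-1 (X (last k_dflt (ksigma k s))) (jet_base z).
  rewrite (eq_bigr (fun t => H (take M.-1 (perm_seq t)) (drop M.-1 (perm_seq t)))); last first.
    by move=> t _; rewrite /H itauE map_take map_drop.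
  rewrite sum_shuffles mulr_suml [RHS]exchange_big; apply: eq_bigr => C /eqP CM.
  rewrite /H; have := size_ksigma k s.
  (* [M_gt0] excludes the empty list, so [last] returns a true entry. *)
  case/lastP: (ksigma k s) => [M0|w l]; first by exfalso; move: M_gt0; rewrite -M0.
  rewrite size_rcons => wM; have M1 : M.-1 = size w by rewrite -wM.
  rewrite M1 last_rcons -cats1 take_size_cat // kroneckerE; last first.
    by rewrite size_map -cardE CM.
  rewrite (bigD1 l) //= cats1 eqseq_rcons eqxx andbT big1 ?addr0 => [|k0 ne].
    by rewrite mulrA.
  by rewrite eqseq_rcons (negbTE ne) andbF mul0r.
apply: eq_bigr => k0 _.
transitivity (\sum_(C : {set 'I_kappa} | #|C| == M.-1)
    \sum_(P | partition P (oset C) &&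
              perm_eq (block_sizes P) (type_sizes lam mu))
       c k0 C * block_mon (oidx i k0) P z).
  apply: eq_bigr => C /eqP CM.
  (* [None] stands last, in the place of k_{sigma(M)}. *)
  pose w := rcons (map Some (enum C)) None.
  pose f (j : 'I_M) := nth None w j.
  have szw : size w = M by rewrite size_rcons size_map -cardE CM prednK.
  have uw : uniq w.
    rewrite rcons_uniq map_inj_uniq ?enum_uniq; last by move=> ? ? [].
    by rewrite andbT; apply/mapP => -[].
  have fI : injective f.
    move=> j j' /eqP; rewrite nth_uniq ?szw // => /eqP; exact: val_inj.
  have fE : map f (enum 'I_M) = w.
    rewrite -[RHS](mkseq_nth None) szw /mkseq -val_enum_ord -map_comp.
    exact: eq_map.
  have fC : f @: setT = oset C.
    apply/setP => x; transitivity (x \in w).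
      rewrite -fE; apply/imsetP/mapP => -[j _ ->];
        by exists j; rewrite ?inE ?mem_enum.
    rewrite mem_rcons !inE; congr (_ || _).
    by apply/mapP/imsetP => -[y yC ->]; exists y; rewrite // ?mem_enum // -mem_enum.
  rewrite -fC -(sum_slot_mon (oidx i k0) _ fI); apply: eq_bigr => s _.
  rewrite -(sum_reindexed s (oidx i k0 \o f) (fun k => _ * slot_mon k)).
  apply: eq_bigr => k _; congr ((_ == _)%:R * _).
  by rewrite (map_comp (oidx i k0) f) fE map_rcons -map_comp.
rewrite (exchange_big_dep (fun P : {set {set option 'I_kappa}} =>
  (ppart setT P && (None \in cover P)) &&
  perm_eq (block_sizes P) (type_sizes lam mu))) /=; last first.
  move=> C P _; rewrite partition_coverE => /andP[/andP[-> /eqP->] ->].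
  by rewrite !inE.
apply: eq_bigr => P /andP[/andP[pP NP] sP].
(* The subset C is recovered from [P] as its cover without [None]. *)
pose D := [set x | Some x \in cover P].
have coverE : cover P = oset D.
  by apply/setP => -[x|]; rewrite ?Some_oset !inE ?NP.
rewrite (big_pred1 D).
  rewrite /faa_term (_ : [set None] != set0); last first.
    by apply/set0Pn; exists None; rewrite inE.
  rewrite (type_card sP) subn1 setTD /c.
  suff sC : perm_eq (map i (enum (~: D)))
      (map (oidx i k0) (enum (~: cover P))).
    by rewrite (pd_xy_perm pdC _ (X_smooth k0) sC).
  have -> : map i (enum (~: D)) = map (oidx i k0) (map Some (enum (~: D))).
    exact: (map_comp (oidx i k0) Some).
  apply: perm_map; apply: uniq_perm; rewrite ?enum_uniq //.
    by rewrite map_inj_uniq ?enum_uniq //; move=> ? ? [].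
  move=> [x|]; rewrite mem_enum coverE inE ?Some_oset.
    by rewrite mem_map ?mem_enum ?inE //; move=> ? ? [].
  by rewrite !inE /=; apply/mapP => -[].
move=> C; rewrite partition_coverE pP sP andbT /=.
have [->|ne] := eqVneq C D.
  have /and3P[tP _ _] := pP; have := type_card_cover tP sP.
  rewrite coverE eqxx andbT /oset cardsU1 card_imset; last by move=> ? ? [].
  rewrite (_ : None \notin _) ?add1n => [<-|]; first by rewrite eqxx.
  by apply/imsetP => -[].
apply/negbTE; rewrite negb_and; apply/orP; right; apply: contra ne => /eqP CE.
by apply/eqP/setP => x; rewrite -Some_oset -CE inE.
Qed.

End FixedType.

(** * Summation over all types *)

Section AllTypes.
Variable kappa : nat.

Lemma exchange_types (V : nmodType) (I : finType) (Q : pred I)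
  (G : forall d, {ffun 'I_d -> 'I_kappa.+1} -> {ffun 'I_d -> 'I_kappa.+2} -> I -> V) :
  \sum_(1 <= d < kappa.+2)
  \sum_(lam : {ffun 'I_d -> 'I_kappa.+1} |
          [forall e : 'I_d, 1 <= lam e]%N &&
          [forall e : 'I_d, forall e' : 'I_d, (e < e') ==> (lam e < lam e')]%N)
  \sum_(mu : {ffun 'I_d -> 'I_kappa.+2} |
          [forall e : 'I_d, 1 <= mu e]%N && (weight lam mu <= kappa.+1)%N)
  \sum_(j | Q j) G d lam mu j =
  \sum_(j | Q j) \sum_(1 <= d < kappa.+2)
  \sum_(lam : {ffun 'I_d -> 'I_kappa.+1} |
          [forall e : 'I_d, 1 <= lam e]%N &&
          [forall e : 'I_d, forall e' : 'I_d, (e < e') ==> (lam e < lam e')]%N)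
  \sum_(mu : {ffun 'I_d -> 'I_kappa.+2} |
          [forall e : 'I_d, 1 <= mu e]%N && (weight lam mu <= kappa.+1)%N)
    G d lam mu j.
Proof.
rewrite [RHS]exchange_big; apply: eq_bigr => d _.
rewrite [RHS]exchange_big; apply: eq_bigr => lam _.
by rewrite [RHS]exchange_big.
Qed.

(** By [sum_types] a non-empty family with blocks of size at most kappa is counted for exactly one
    type; the bound on the cardinality of [T] yields the bound on the weight. *)
Lemma sum_all_types (V : nmodType) (T : finType) (Q : pred {set {set T}})
    (G : {set {set T}} -> V) :
  (#|T| <= kappa.+1)%N -> (forall P, Q P -> ppart setT P) ->
  \sum_(1 <= d < kappa.+2)
  \sum_(lam : {ffun 'I_d -> 'I_kappa.+1} |
          [forall e : 'I_d, 1 <= lam e]%N &&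
          [forall e : 'I_d, forall e' : 'I_d, (e < e') ==> (lam e < lam e')]%N)
  \sum_(mu : {ffun 'I_d -> 'I_kappa.+2} |
          [forall e : 'I_d, 1 <= mu e]%N && (weight lam mu <= kappa.+1)%N)
  \sum_(P | Q P && perm_eq (block_sizes P) (type_sizes lam mu)) G P =
  \sum_(P | Q P && ((P != set0) && all (leq^~ kappa) (block_sizes P))) G P.
Proof.
move=> Tk QP; pose G' d (lam : {ffun 'I_d -> 'I_kappa.+1})
    (mu : {ffun 'I_d -> 'I_kappa.+2}) P :=
  if perm_eq (block_sizes P) (type_sizes lam mu) then G P else 0.
transitivity (\sum_(1 <= d < kappa.+2)
  \sum_(lam : {ffun 'I_d -> 'I_kappa.+1} |
          [forall e : 'I_d, 1 <= lam e]%N &&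
          [forall e : 'I_d, forall e' : 'I_d, (e < e') ==> (lam e < lam e')]%N)
  \sum_(mu : {ffun 'I_d -> 'I_kappa.+2} |
          [forall e : 'I_d, 1 <= mu e]%N && (weight lam mu <= kappa.+1)%N)
  \sum_(P | Q P) G' d lam mu P).
  apply: eq_bigr => d _; apply: eq_bigr => lam _; apply: eq_bigr => mu _.
  exact: big_mkcondr.
rewrite exchange_types [RHS]big_mkcondr; apply: eq_bigr => P /QP pP.
have /ppartP[tP P0 _] := pP.
case: ifP => [/andP[Pn /allP Pk]|NP].
  apply: sum_types.
  - by rewrite -size_eq0 size_map -cardE cards_eq0.
  - move=> m mP; rewrite (Pk _ mP) andbT; case/mapP: mP => B.
    by rewrite mem_enum => /P0[y yB] ->; apply/card_gt0P; exists y.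
  - rewrite /block_sizes sumnE big_map big_enum /=.
    have /and3P[/eqP -> _ _] := pP.
    exact: leq_trans (max_card _) Tk.
(* The other families have no type: d and the multiplicities are positive, which excludes the empty
   family, and a size above kappa is not a value of [lam]. *)
rewrite big_nat_cond big1 // => d; rewrite andbT => /andP[d0 _].
apply: big1 => lam _; apply: big1 => mu /andP[/forallP mu_gt0 _].
rewrite /G'; case: ifP => // sP; move/negbT: NP; rewrite negb_and negbK.
case/orP=> [/eqP P0'|/allPn[m]].
  have := perm_size sP; rewrite size_type_sizes size_map -cardE P0' cards0.
  rewrite (bigD1 (Ordinal d0)) //= => /eqP; rewrite eq_sym addn_eq0.
  by have := mu_gt0 (Ordinal d0); rewrite lt0n => /negbTE ->.
rewrite (perm_mem sP) => /flattenP[_ /mapP[e _ ->]]; rewrite mem_nseq.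
by case/andP=> _ /eqP ->; rewrite -ltnS ltn_ord.
Qed.

End AllTypes.

(** * Splitting off the exceptional families *)

Section FaaTop.
Variables (K : numFieldType) (n kappa : nat) (i : 'I_kappa -> 'I_n) (f : base K n -> K).
Variable z : jet K n.
Let i0 := [seq i a | a <- enum 'I_kappa].

(** The empty family gives the pure x-derivative, and kappa positions admit no block of size above
    kappa. *)
Lemma faa_sum_split :
  faa_sum i f set0 [set: 'I_kappa] z = pd_xy i0 0 f (jet_base z) +
  \sum_(P | ppart setT P &&
            ((P != set0) && all (leq^~ kappa) (block_sizes P)))
    faa_term i f set0 [set: 'I_kappa] P z.
Proof.
rewrite /faa_sum (eq_bigl (ppart setT)); last first.
  by move=> P; rewrite sub0set andbT.
rewrite (bigD1 set0) /=; last first.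
  by apply/ppartP; split=> [B C y|B|B y]; rewrite inE.
congr (_ + _).
  rewrite /faa_term /block_mon big_set0 mulr1 cards0 sub0n.
  rewrite /cover big_set0 setD0 /i0.
  rewrite (_ : enum [set: 'I_kappa] = enum 'I_kappa) //.
  by apply: eq_enum => x; rewrite inE.
apply: eq_bigl => P; rewrite (_ : all _ _) ?andbT //; apply/allP => _ /mapP[B _ ->].
by rewrite (leq_trans (max_card _)) // card_ord.
Qed.

(** Among kappa + 1 positions a block of size above kappa is everything, so the size bound excludes
    just the one-block family; covering [None] already excludes the empty one. *)
Lemma faa_sum_oidx_split k :
  faa_sum (oidx i k) f [set None] [set: option 'I_kappa] z =
  f (jet_base z) * jet_y z (k :: i0) +
  \sum_(P | (ppart setT P && (None \in cover P)) &&
            ((P != set0) && all (leq^~ kappa) (block_sizes P)))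
    faa_term (oidx i k) f [set None] [set: option 'I_kappa] P z.
Proof.
rewrite /faa_sum (eq_bigl (fun P => ppart setT P && (None \in cover P)));
  last by move=> P; rewrite sub1set.
have cT : #|[set: option 'I_kappa]| = kappa.+1.
  by rewrite cardsT card_option card_ord.
rewrite (bigD1 [set [set: option 'I_kappa]]) /=; last first.
  rewrite cover1 inE andbT; apply/ppartP; split.
  - by move=> B C y; rewrite !inE => /eqP-> /eqP->.
  - by move=> B; rewrite inE => /eqP->; exists None; rewrite inE.
  - by move=> B y _; rewrite inE.
congr (_ + _).
  rewrite /faa_term /block_mon big_set1 cards1 cover1.
  rewrite (_ : [set None] != set0); last first.
    by apply/set0Pn; exists None; rewrite inE.
  rewrite setDv enum_set0; congr (_ * _); apply: jet_y_perm.
  rewrite (_ : k :: i0 = map (oidx i k) (None :: map Some (enum 'I_kappa))).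
    apply: perm_map; apply: uniq_perm; rewrite ?enum_uniq //=.
      rewrite map_inj_uniq ?enum_uniq ?andbT; last by move=> ? ? [].
      by apply/mapP => -[].
    move=> x; rewrite mem_enum !inE; case: x => [x|] //=.
    by rewrite mem_map ?mem_enum //; move=> ? ? [].
  by rewrite /= -map_comp.
apply: eq_bigl => P; have [pP|//] := boolP (ppart _ _).
have [NP|//] := boolP (None \in _); rewrite /=.
have /ppartP[tP P0 _] := pP; have /bigcupP[B0 B0P _] := NP.
have -> /= : P != set0 by apply/set0Pn; exists B0.
apply/idP/allP => [ne _ /mapP[B] + ->|PK].
  rewrite mem_enum => BP; rewrite leqNgt; apply: contra ne => Bk.
  have BT : B = setT.
    by apply/eqP; rewrite eqEcard subsetT cT.
  apply/eqP/setP => C; rewrite inE; apply/idP/eqP => [CP|->]; last by rewrite -BT.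
  have [y yC] := P0 _ CP; rewrite -BT; apply: (tP _ _ y) => //.
  by rewrite BT inE.
apply/eqP => PE; have := PK kappa.+1; rewrite ltnn => H; apply: notF; apply: H.
by apply/mapP; exists setT; rewrite ?mem_enum ?PE ?inE ?cT.
Qed.

End FaaTop.

Theorem theorem3p73 (R : realType) (c : scalar_kind) (n : nat) (n_gt0 : (0 < n)%N)
    (X : 'I_n -> base (scalars R c) n -> scalars R c)
    (Y : base (scalars R c) n -> scalars R c)
    (X_smooth : forall k : 'I_n, smooth (X k)) (Y_smooth : smooth Y)
    (kappa : nat) (kappa_gt0 : (0 < kappa)%N)
    (F : forall (d : nat) (lam : {ffun 'I_d -> 'I_kappa.+1})
                (mu : {ffun 'I_d -> 'I_kappa.+2}), {set 'S_(weight lam mu)})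
    (F_reps : forall (d : nat) (lam : {ffun 'I_d -> 'I_kappa.+1})
                     (mu : {ffun 'I_d -> 'I_kappa.+2}), coset_reps (F d lam mu))
    (i : kappa.-tuple 'I_n) (z : jet (scalars R c) n) :
  prolong X Y i z =
  pd_xy i 0 Y (jet_base z) +
  \sum_(1 <= d < kappa.+2)
  \sum_(lam : {ffun 'I_d -> 'I_kappa.+1} |
          [forall e : 'I_d, 1 <= lam e]%N &&
          [forall e : 'I_d, forall e' : 'I_d, (e < e') ==> (lam e < lam e')]%N)
  \sum_(mu : {ffun 'I_d -> 'I_kappa.+2} |
          [forall e : 'I_d, 1 <= mu e]%N && (weight lam mu <= kappa.+1)%N)
  \sum_(k : {ffun 'I_(weight lam mu) -> 'I_n})
    (let M := weight lam mu in
     let p := (\sum_(e < d) mu e)%N in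
     let ksigma (sigma : 'S_(weight lam mu)) : seq 'I_n :=
       [seq k (sigma j) | j <- enum 'I_(weight lam mu)] in
     let itau (tau : 'S_kappa) : seq 'I_n :=
       [seq tnth i (tau j) | j <- enum 'I_kappa] in
     (\sum_(sigma in F d lam mu) \sum_(tau in shuffles kappa M)
        (kronecker (take M (itau tau)) (take M (ksigma sigma)))%:R *
        pd_xy (drop M (itau tau)) p Y (jet_base z)
      - \sum_(sigma in F d lam mu) \sum_(tau in shuffles kappa M.-1)
        (kronecker (take M.-1 (itau tau)) (take M.-1 (ksigma sigma)))%:R *
        (* M > 0 here, so the default value of [last] is irrelevant *)
        pd_xy (drop M.-1 (itau tau)) p.-1
          (X (last (Ordinal n_gt0) (ksigma sigma))) (jet_base z))
     * \prod_(e < d) \prod_(nu < mu e)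
         jet_y z [seq k (slot nu g) | g <- enum 'I_(lam e)]).
Proof.
have pdC : @symmetric_pd (scalars R c) n by move=> f c1 c2; apply: schwarz.
have iE : tval i = [seq tnth i a | a <- enum 'I_kappa] by rewrite map_tnth_enum.
pose QX (P : {set {set option 'I_kappa}}) :=
  ppart setT P && (None \in cover P).
rewrite iE prolong_faa // faa_sum_split -!addrA; congr (_ + _).
have -> : - (\sum_(k < n) faa_sum (oidx (tnth i) k) (X k) [set None]
      [set: option 'I_kappa] z) +
    \sum_(k < n) lift_base (X k) z * jet_y z (k :: [seq tnth i a | a <- enum 'I_kappa]) =
    - \sum_(k < n) \sum_(P | QX P &&
            ((P != set0) && all (leq^~ kappa) (block_sizes P)))
    faa_term (oidx (tnth i) k) (X k) [set None] [set: option 'I_kappa] P z.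
  rewrite addrC -sumrB -sumrN; apply: eq_bigr => k _.
  by rewrite faa_sum_oidx_split opprD addrA subrr add0r.
rewrite -(@sum_all_types kappa) //; last by rewrite card_ord.
under [X in _ - X]eq_bigr => k _.
  rewrite -(@sum_all_types kappa); first last.
  - by move=> P /andP[].
  - by rewrite card_option card_ord.
  over.
(* The component index moves inside, so that both sums are compared type by type; the range of d is
   retained because d > 0 gives M > 0. *)
rewrite -(@exchange_types kappa) -sumrB big_nat_cond [RHS]big_nat_cond.
apply: eq_bigr => d /andP[/andP[d_gt0 _] _]; rewrite -sumrB.
apply: eq_bigr => lam /andP[/forallP lam_gt0 lam_lt]; rewrite -sumrB.
apply: eq_bigr => mu /andP[/forallP mu_gt0 _].
have lam_inj := increasing_inj lam_lt.
have M_gt0 : (0 < weight lam mu)%N.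
  rewrite /weight (bigD1 (Ordinal d_gt0)) //= addn_gt0 muln_gt0.
  by rewrite lam_gt0 mu_gt0.
rewrite -(sum_fixed_type_Y (tnth i) kappa_gt0 lam_gt0 lam_inj z M_gt0 (F_reps d lam mu)).
rewrite -(sum_fixed_type_X (tnth i) lam_gt0 lam_inj z M_gt0 (F_reps d lam mu) pdC
  X_smooth (Ordinal n_gt0)).
by rewrite -sumrB; apply: eq_bigr => k _; rewrite -mulrBl.
Qed.
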